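(* Let $\Omega\subset\mathbb{R}^3$ be a bounded polyhedral domain with a conforming simplicial finite element mesh $\mathcal{T}$, and let $k\ge 3$ be odd. Let $E\in\mathcal{E}$ be a critical edge and assume that there is a tetrahedron $K\in\mathcal{T}_E$ with two facets $F,G\in\mathcal{F}(K)$ which satisfy $$F,G\in\mathcal{F}_\Omega,\qquad E\subset F,\qquad E\not\subset G.$$ For $\mathbf{p}\in\mathcal{V}(E)$ let $p_{k-1}^{E,\mathbf{p}}$ be the critical pressure function associated with $E$ and $\mathbf{p}$ (defined in the context). For any $F'\in\mathcal{F}_\Omega$ let $\mathbf{w}_\ell^{F'}\in\mathbb{R}^3$, $1\le\ell\le 3$, denote some basis of $\mathbb{R}^3$. Then any function $p\in\operatorname{span}\{p_{k-1}^{E,\mathbf{p}}:\mathbf{p}\in\mathcal{V}(E)\}$ which satisfies $$(p,\operatorname{div}\mathbf{v})_{L^2(\Omega)}=0\qquad\forall\,\mathbf{v}\in\operatorname{span}\{B_k^{\mathrm{CR},F'}\mathbf{w}_\ell^{F'}:1\le\ell\le 3,\ F'\in\{F,G\}\}$$ is the zero function.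
   Context: $\mathcal{T}$ consists of closed tetrahedra. $\mathcal{F}$ and $\mathcal{E}$ are the sets of all (two-dimensional) facets and (one-dimensional) edges of the mesh; $\mathcal{F}_{\partial\Omega}:=\{F\in\mathcal{F}:F\subset\partial\Omega\}$, $\mathcal{F}_\Omega:=\mathcal{F}\setminus\mathcal{F}_{\partial\Omega}$ (inner facets), $\mathcal{E}_{\partial\Omega}:=\{E\in\mathcal{E}: E\subset\partial\Omega\}$ (outer edges), $\mathcal{E}_\Omega:=\mathcal{E}\setminus\mathcal{E}_{\partial\Omega}$ (inner edges). $\mathcal{F}(K)$ is the set of the four facets of $K$. For $E\in\mathcal{E}$, $\mathcal{T}_E:=\{K\in\mathcal{T}:E\subset K\}$ and $\mathcal{V}(E)$ is the set of the two endpoints of $E$; for $F\in\mathcal{F}$, $\mathcal{T}_F:=\{K\in\mathcal{T}:F\subset K\}$. For a vertex $\mathbf{z}$ of $K$, $\lambda_{K,\mathbf{z}}$ is the barycentric coordinate, i.e. the affine function on $K$ equal to $1$ at $\mathbf{z}$ and $0$ at the other vertices of $K$; $|K|$ is the volume of $K$ and $\chi_K$ its characteristic function. An edge $E\in\mathcal{E}$ is critical in $\mathcal{T}$ if all facets $F\in\mathcal{F}$ with $E\subset F$ lie in at most two flat planes. If a critical edge $E$ is inner, $\mathcal{T}_E$ consists of exactly four tetrahedra $K_1,\dots,K_4$, numbered cyclically ($K_5:=K_1$) so that $K_i$ and $K_{i+1}$ share a facet $F_i$, with $F_1,F_3$ lying in one plane and $F_2,F_4$ in one other plane. If a critical edge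 $E$ is outer, $\mathcal{T}_E=\{K_i:1\le i\le\iota_E\}$ with $\iota_E\in\{1,2,3\}$, numbered so that $K_i$ and $K_{i+1}$ share a facet. $P_n^{(\alpha,\beta)}$ denotes the Jacobi polynomial of degree $n$, orthogonal on $[-1,1]$ to all polynomials of degree less than $n$ with respect to the weight $(1-x)^\alpha(1+x)^\beta$, normalized by $P_n^{(\alpha,\beta)}(1)=(\alpha+1)_n/n!$ with $(a)_n=a(a+1)\cdots(a+n-1)$, $(a)_0=1$. For a critical edge $E$ and $\mathbf{p}\in\mathcal{V}(E)$, $$p_{k-1}^{E,\mathbf{p}}:=\sum_{i=1}^{\iota_E}\frac{(-1)^i}{|K_i|}\,\chi_{K_i}\,P_{k-1}^{(0,3)}(1-2\lambda_{K_i,\mathbf{p}}),$$ where $\iota_E=4$ if $E\in\mathcal{E}_\Omega$ and $\iota_E\in\{1,2,3\}$ if $E\in\mathcal{E}_{\partial\Omega}$. With $L_k=P_k^{(0,0)}$ the Legendre polynomials and $Q_k:=\frac{1}{k+1}(L_{k+1}-L_k)'$, for odd $k$ and $F'\in\mathcal{F}_\Omega$ the facet-oriented Crouzeix-Raviart function is $$B_k^{\mathrm{CR},F'}:=Q_k(1-2\lambda_{K',\mathbf{z}})\ \text{ on each }K'\in\mathcal{T}_{F'},\qquad B_k^{\mathrm{CR},F'}:=0\ \text{ otherwise,}$$ where $\mathbf{z}$ is the vertex of $K'$ opposite to $F'$. For such discontinuous piecewise polynomial $\mathbf{v}$, the divergence is taken elementwise: $(p,\operatorname{div}\mathbf{v})_{L^2(\Omega)}=\sum_{K'\in\mathcal{T}}\int_{K'}p\,\operatorname{div}\mathbf{v}$.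 *)

(* Defs.v *)
From HB Require Import structures.
From mathcomp Require Export all_boot all_order all_algebra finmap.
From mathcomp Require Export all_classical all_reals all_analysis.
Set Implicit Arguments.
Unset Strict Implicit.
Unset Printing Implicit Defensive.
Import Order.TTheory GRing.Theory Num.Theory.
Import numFieldNormedType.Exports.
Local Open Scope classical_set_scope.
Local Open Scope ring_scope.

Section Generic.
Variables (R : realType) (M : lmodType R).

Definition lspan (A : set M) : set M :=
  [set u | exists (n : nat) (a : 'I_n -> R) (e : 'I_n -> M),
     (forall i, A (e i)) /\ u = \sum_(i < n) a i *: e i].

End Generic.

Section Jacobi.
Variable R : realType.

Definition is_jacobi (a b n : nat) (P : {poly R}) : Prop :=
  [/\ size P = n.+1,
      forall q : {poly R}, (size q <= n)%N ->
        (\int[lebesgue_measure]_(x in `[-1, 1])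
           ((1 - x) ^+ a * (1 + x) ^+ b * P.[x] * q.[x]))%R = 0
    & P.[1] = (\prod_(i < n) (a + 1 + i)%N%:R) / n`!%:R].

(* The polynomial singled out by [is_jacobi]; the default 0 is never reached,
   since there is exactly one such polynomial. *)
Definition jacobi (a b n : nat) : {poly R} := xget 0 (is_jacobi a b n).

Definition legendre (n : nat) : {poly R} := jacobi 0 0 n.

Definition CR_Q (k : nat) : {poly R} :=
  (k.+1%:R)^-1 *: (legendre k.+1 - legendre k)^`().

End Jacobi.

Section Space.
Variable R : realType.
Local Notation V := 'rV[R]_3.

(* A simplex (vertex, edge, triangle, tetrahedron) is encoded by the finite set
   of its vertices; the closed point set it denotes is the convex hull. *)
Definition hull (S : {fset V}) : set V :=
  [set x | exists c : V -> R,
     [/\ forall v, v \in S -> 0 <= c v,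
         \sum_(v <- S) c v = 1
       & x = \sum_(v <- S) c v *: v]].

Definition affinely_independent (S : {fset V}) : Prop :=
  forall c : V -> R, \sum_(v <- S) c v = 0 -> \sum_(v <- S) c v *: v = 0 ->
  forall v, v \in S -> c v = 0.

(* n is the number of vertices: triangles are 3-simplexes, tetrahedra 4-simplexes. *)
Definition simplex (n : nat) (S : {fset V}) : Prop :=
  #|` S| = n /\ affinely_independent S.

Definition plane (H : set V) : Prop :=
  exists (a : V) (b : R), a != 0 /\ H = [set x | \sum_i a 0 i * x 0 i = b].

Definition affine_fun (f : V -> R) : Prop :=
  exists (a : V) (b : R), forall x, f x = b + \sum_i a 0 i * x 0 i.

(* For a tetrahedron K the defining conditions determine an affine function on
   the whole space; it is the extension of the barycentric coordinate from K. *)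
Definition bary (K : {fset V}) (z : V) : V -> R :=
  get [set f | [/\ affine_fun f, f z = 1
                 & forall y, y \in K -> y != z -> f y = 0]].

Definition frontier (A : set V) : set V := closure A `\` interior A.

(* Three-dimensional Lebesgue measure, on triples of coordinates. *)
Definition leb3 := ((@lebesgue_measure R \x @lebesgue_measure R)
                     \x @lebesgue_measure R)%E.

Definition of_coords (x : R * R * R) : V :=
  \row_(i < 3) [:: x.1.1; x.1.2; x.2]`_i.

Definition volume (A : set V) : R := fine (leb3 (of_coords @^-1` A)).

Definition integral3 (A : set V) (f : V -> R) : R :=
  (\int[leb3]_(x in of_coords @^-1` A) f (of_coords x))%R.

Definition div (v : V -> V) (x : V) : R :=
  \sum_(i < 3) 'D_(delta_mx 0 i) (fun y => v y 0 i) x.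

End Space.

Section Mesh.
Variables (R : realType).
Local Notation V := 'rV[R]_3.
Variables (Omega : set V) (T : {fset {fset V}}).

Definition polyhedral_domain : Prop :=
  [/\ open Omega, connected Omega, Omega !=set0, bounded_set Omega
    & exists S : {fset {fset V}}, (forall F, F \in S -> simplex 3 F) /\
        frontier Omega = \bigcup_(F in [set` S]) hull F].

Definition conforming_mesh : Prop :=
  [/\ forall K, K \in T -> simplex 4 K,
      forall K K', K \in T -> K' \in T ->
        exists S : {fset V}, [/\ (S `<=` K)%fset, (S `<=` K')%fset
                               & (hull K `&` hull K' = hull S)]
    & closure Omega = \bigcup_(K in [set` T]) hull K].

Definition facet_of (K F : {fset V}) : Prop := (F `<=` K)%fset /\ #|` F| = 3%N.

Definition facet (F : {fset V}) : Prop := exists2 K, K \in T & facet_of K F.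

Definition edge (E : {fset V}) : Prop :=
  exists2 K, K \in T & (E `<=` K)%fset /\ #|` E| = 2%N.

Definition outer (S : {fset V}) : Prop := (hull S `<=` frontier Omega).

Definition inner_facet (F : {fset V}) : Prop := facet F /\ ~ outer F.

Definition inner_edge (E : {fset V}) : Prop := edge E /\ ~ outer E.

(* The tetrahedra containing a facet or an edge S, that is, T_S. *)
Definition star (S : {fset V}) : set {fset V} :=
  [set K | K \in T /\ (hull S `<=` hull K)].

Definition critical (E : {fset V}) : Prop :=
  edge E /\ exists H1 H2 : set V, [/\ plane H1, plane H2
    & forall F, facet F -> (hull E `<=` hull F) ->
        (hull F `<=` H1) \/ (hull F `<=` H2)].

Definition share_facet (K K' : {fset V}) : Prop :=
  exists2 F, facet_of K F & facet_of K' F.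

(* Ks lists the tetrahedra around E so that neighbours in the list share a facet,
   cyclically if E is inner.  The number of tetrahedra is [size Ks]; for critical
   E its value (4 if E is inner, otherwise 1, 2 or 3 unless Omega has slits along E)
   is a consequence of the geometry and is not prescribed. *)
Definition star_numbering (E : {fset V}) (Ks : seq {fset V}) : Prop :=
  [/\ uniq Ks,
      [set` Ks] = star E,
      forall i, (i.+1 < size Ks)%N ->
        share_facet (nth fset0 Ks i) (nth fset0 Ks i.+1)
    & inner_edge E -> share_facet (last fset0 Ks) (head fset0 Ks)].

(* Ks is indexed from 0, hence the exponent i.+1. *)
Definition critical_pressure (Ks : seq {fset V}) (k : nat) (z : V) : V -> R^o :=
  fun x => \sum_(i < size Ks)
    let K := nth fset0 Ks i in
    (-1) ^+ i.+1 / volume (hull K) * \1_(hull K) x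
      * (jacobi R 0 3 k.-1).[1 - 2 * bary K z x].

(* A piecewise function is given by its branch on every tetrahedron K; for
   piecewise polynomials the branch is a polynomial on the whole space, so no
   value has to be chosen where tetrahedra meet, and the elementwise divergence
   is the divergence of the branches. *)
Definition piecewise (W : Type) := {fset V} -> V -> W.

Definition opposite_vertex (K F : {fset V}) : V := xget 0 [set` (K `\` F)%fset].

Definition CR_B (k : nat) (F : {fset V}) : piecewise R := fun K x =>
  if `[< star F K >]
  then (CR_Q R k).[1 - 2 * bary K (opposite_vertex K F) x] else 0.

Definition L2_div (p : V -> R) (v : piecewise V) : R :=
  \sum_(K <- T) integral3 (hull K) (fun x => p x * div (v K) x).

Definition critical_pressure_span (Ks : seq {fset V}) (k : nat) (E : {fset V})
  : set (V -> R^o) :=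
  lspan [set q | exists2 z, z \in E & q = critical_pressure Ks k z].

Definition CR_span (k : nat) (w : {fset V} -> 3.-tuple V) (A : set {fset V})
  : set (piecewise V) :=
  @lspan R ({fset V} -> V -> V)
    [set v | exists (F : {fset V}) (l : 'I_3), A F /\
       v = fun K x => CR_B k F K x *: tnth (w F) l].

End Mesh.

(* Main.v *)
Require Import Defs.
From mathcomp Require Import ring lra measurable_realfun.
Set Implicit Arguments.
Unset Strict Implicit.
Unset Printing Implicit Defensive.
Import Order.TTheory GRing.Theory Num.Theory.
Import numFieldNormedType.Exports.
Local Open Scope classical_set_scope.
Local Open Scope ring_scope.

(** Let P be the Jacobi polynomial of degree k - 1 for the weight (1 + x)^3 and
    Q = CR_Q k.  On the i-th tetrahedron K_i of the star of E the pressure p is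
    (-1)^i / |K_i| times the sum over z in E of c_z P(1 - 2 lambda_z), and the
    divergence of the facet function in the direction w is
    -2 Q'(1 - 2 lambda_a) <grad lambda_a, w>, with a the vertex opposite to the
    facet.  Everything thus depends on the integrals over a tetrahedron K of
    P(1 - 2 lambda_b) Q'(1 - 2 lambda_a).  By [integral_jacobi] such an integral
    is m |K| Q'(1) if a and b differ and m |K| Q'(-1) if a = b, with the same
    constant m, which is nonzero and does not depend on K.  The reason is that
    the conditional mean of lambda_a^i given lambda_b = t is a multiple of
    (1 - t)^i, while lambda_b has density 3 (1 - t)^2: for i >= 1 a weight
    (1 - t)^3 splits off, and P is orthogonal to the rest.

    Testing with G: the vertex z0 of K opposite to G belongs to E, so a second
    tetrahedron at G does not contain E, and p vanishes almost everywhere on it.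
    Hence c_z0 Q'(-1) + c_z Q'(1) = 0, where z is the other end of E.

    Testing with F: another tetrahedron K' at F also lies in the star.  The
    gradients of the two barycentric coordinates are negative multiples of each
    other ([opposite_sides]) and the signs of p are opposite as well
    ([neighbours_opposite_parity]), so the two contributions cannot cancel, and
    (c_z0 + c_z) Q'(1) = 0.  Legendre's differential equation gives
    Q'(1) = k (k + 2) / 2 and Q'(-1) = k (k + 1) (k + 2) / 4 for odd k; these are
    nonzero and different, hence c = 0.

    The parity statement is a two-colouring: two different facets of one
    tetrahedron never lie in one plane, so the facets met when turning around E
    alternate between the two planes of the definition of a critical edge, and a
    closed chain of tetrahedra around E has even length.

    The moments of barycentric coordinates need no change of variables to a
    reference tetrahedron.  The homothety with centre b and ratio u maps K onto
    the part of K where lambda_b >= 1 - u; it multiplies volumes by u^3,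
    lambda_a by u for a different from b, and 1 - lambda_b by u.
    On the remaining slice 1 - lambda_b lies between u and 1, and letting u tend to 1 determines the moments
    ([moment_squeeze], [moment]).  The same homotheties show that facets have
    measure zero ([facet_plane_null]), so that overlaps of tetrahedra do not
    contribute. *)

(** * Integrals of polynomials over the interval from -1 to 1 *)

Section Polynomials.
Variable R : realType.
Implicit Types (p q P : {poly R}) (n : nat).

Definition polyint p : R := \int[lebesgue_measure]_(x in `[(-1), 1]) p.[x].

Lemma polyint_deriv p : polyint p^`() = p.[1] - p.[-1].
Proof.
rewrite /polyint /Rintegral (@continuous_FTC2 _ (horner p^`()) (horner p)) //.
- by apply: continuous_subspaceT; exact: continuous_horner.
- split.
  + by move=> x _; exact: derivable_horner.
  + by apply: cvg_at_right_filter; exact: continuous_horner.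
  + by apply: cvg_at_left_filter; exact: continuous_horner.
- by move=> x _; rewrite derivE.
Qed.

Definition antideriv p : {poly R} := \poly_(i < (size p).+1) (p`_i.-1 / i%:R).

Lemma antiderivK p : (antideriv p)^`() = p.
Proof.
apply/polyP => i; rewrite coef_deriv coef_poly ltnS.
case: ltnP => [ip|pi]; first by rewrite -[LHS]mulr_natr divfK// pnatr_eq0.
by rewrite mul0rn nth_default.
Qed.

Lemma polyint_antideriv p : polyint p = (antideriv p).[1] - (antideriv p).[-1].
Proof. by rewrite -polyint_deriv antiderivK. Qed.

Lemma polyintD p q : polyint (p + q) = polyint p + polyint q.
Proof.
rewrite -{1}(antiderivK p) -{1}(antiderivK q) -derivD polyint_deriv !hornerD.
rewrite !polyint_antideriv; ring.
Qed.

Lemma polyintZ a p : polyint (a *: p) = a * polyint p.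
Proof.
by rewrite -{1}(antiderivK p) -derivZ polyint_deriv !hornerZ polyint_antideriv mulrBr.
Qed.

Lemma polyint_sum I (r : seq I) (F : I -> {poly R}) :
  polyint (\sum_(i <- r) F i) = \sum_(i <- r) polyint (F i).
Proof.
apply: (big_morph polyint polyintD).
by rewrite -(scale0r 0) polyintZ mul0r.
Qed.

Lemma polyint_parts p q :
  polyint (p^`() * q) = (p * q).[1] - (p * q).[-1] - polyint (p * q^`()).
Proof. by rewrite -polyint_deriv derivM polyintD addrK. Qed.

(** An antiderivative is monotone with equal values at both ends, hence constant
    at infinitely many points. *)
Lemma polyint_ge0_eq0 p :
  (forall x : R, -1 <= x <= 1 -> 0 <= p.[x]) -> polyint p = 0 -> p = 0.
Proof.
move=> p0; rewrite polyint_antideriv; set F := antideriv p => /eqP; rewrite subr_eq0.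
move=> /eqP F11.
have Fndecr : {in `[(-1), 1]%R &, {homo horner F : x y / x <= y}}.
  apply: ger0_derive1_le_cc.
  - by move=> x _; exact: derivable_horner.
  - move=> x; rewrite in_itv/= => /andP[x1 x2].
    by rewrite -derivE antiderivK p0// !ltW.
  - by apply: continuous_subspaceT; exact: continuous_horner.
have Fcst (x : R) : -1 <= x <= 1 -> F.[x] = F.[1].
  move=> /andP[x1 x2]; apply/eqP; rewrite eq_le; apply/andP; split.
    by apply: Fndecr; rewrite // in_itv/= ?x1 ?x2//; lra.
  rewrite F11; apply: Fndecr; rewrite // in_itv/= ?x1 ?x2//; lra.
suff /eqP : F - F.[1]%:P = 0.
  by rewrite subr_eq0 => /eqP /(congr1 deriv); rewrite antiderivK derivC.
pose r := [seq i.+1%:R^-1 : R | i <- iota 0 (size (F - F.[1]%:P))].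
apply: (@roots_geq_poly_eq0 _ _ r).
- apply/allP => _ /mapP[i _ ->]; rewrite rootE !hornerE Fcst ?subrr//.
  have i0 : 0 <= i.+1%:R^-1 :> R by rewrite invr_ge0.
  by rewrite (le_trans (lerN10 R) i0)/= invf_le1// ler1n.
- rewrite map_inj_uniq ?iota_uniq// => i j /invr_inj /eqP.
  by rewrite eqr_nat => /eqP[].
- by rewrite size_map size_iota.
Qed.

(** Splitting off the value at -1 leaves a factor 1 + x, which turns the weight
    (1 + x)^2 into the weight (1 + x)^3 of the pressure. *)
Lemma poly_divXadd1 p : exists2 r, p = p.[-1]%:P + (1 + 'X) * r & (size r <= (size p).-1)%N.
Proof.
have /factor_theorem[r rE] : root (p - p.[-1]%:P) (-1).
  by rewrite rootE !hornerE subrr.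
exists r.
  have -> : 1 + 'X = 'X - (-1)%:P :> {poly R} by rewrite polyCN opprK addrC.
  by rewrite mulrC -rE addrC subrK.
have [->|r0] := eqVneq r 0; first by rewrite size_poly0.
have : (size (p - p.[-1]%:P)%R <= maxn (size p) 1)%N.
  rewrite (leq_trans (size_polyD _ _))// geq_max leq_maxl/= size_polyN.
  by rewrite leq_max (size_polyC_leq1 _) orbT.
rewrite rE size_Mmonic ?monicXsubC// size_XsubC addn2 /=.
have : (0 < size r)%N by rewrite size_poly_gt0.
case: (size p) => [|[|n]]; case: (size r) => [|m] //.
Qed.

(** * Jacobi polynomials *)
Definition orthogonal_below (w : {poly R}) n P :=
  forall q, (size q <= n)%N -> polyint (w * P * q) = 0.

Section Weight.
Variable w : {poly R}.
Hypothesis w_ge0 : forall x : R, -1 <= x <= 1 -> 0 <= w.[x].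
Hypothesis w_neq0 : w != 0.

Lemma polyint_square_eq0 P : polyint (w * P * P) = 0 -> P = 0.
Proof.
move=> /polyint_ge0_eq0 H; apply/eqP.
suff /eqP : w * P * P = 0 by rewrite !mulf_eq0 (negPf w_neq0)/= orbb.
apply: H => x /w_ge0 ?.
by rewrite -mulrA -expr2 hornerM horner_exp mulr_ge0// sqr_ge0.
Qed.

Lemma orthogonal_below_eq0 n P :
  orthogonal_below w n P -> (size P <= n)%N -> P = 0.
Proof. by move=> oP /oP; exact: polyint_square_eq0. Qed.

(** There are n linear conditions on the n + 1 coefficients. *)
Lemma orthogonal_below_exists n : exists P,
  [/\ P != 0, (size P <= n.+1)%N & orthogonal_below w n P].
Proof.
pose A := \matrix_(i < n.+1, j < n) polyint (w * 'X^i * 'X^j).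
have : kermx A != 0.
  rewrite -mxrank_eq0 mxrank_ker subn_eq0 -ltnNge ltnS.
  exact: rank_leq_col.
case/rowV0Pn => u /sub_kermxP uA u0.
exists (rVpoly u); split.
- apply: contra u0 => /eqP H; rewrite -(@rVpolyK _ n.+1 u) H.
  by rewrite linear0.
- exact: size_poly.
- move=> q qn.
  have -> : q = \sum_(j < n) q`_j *: 'X^j.
    rewrite -[LHS](coefK) poly_def (big_ord_widen n (fun i => q`_i *: 'X^i))// big_mkcond/=.
    apply: eq_bigr => j _; case: ltnP => // ?.
    by rewrite nth_default// scale0r.
  rewrite mulr_sumr polyint_sum big1// => j _.
  rewrite -scalerAr polyintZ.
  suff -> : polyint (w * rVpoly u * 'X^j) = 0 by rewrite mulr0.
  move/matrixP/(_ 0 j) : uA; rewrite !mxE => <-.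
  rewrite /rVpoly poly_def mulr_sumr mulr_suml polyint_sum.
  apply: eq_bigr => i _; rewrite mxE insubT//= => ?.
  rewrite -scalerAr -scalerAl polyintZ; congr (u _ _ * _).
  by apply: val_inj.
Qed.

End Weight.

Lemma Rintegral_jacobi a b P q :
  \int[lebesgue_measure]_(x in `[-1, 1]) ((1 - x) ^+ a * (1 + x) ^+ b * P.[x] * q.[x]) =
  polyint ((1 - 'X) ^+ a * (1 + 'X) ^+ b * P * q).
Proof.
by apply: eq_Rintegral => x _; rewrite !hornerM !horner_exp !hornerE.
Qed.

Lemma weight_ge0 a b (x : R) : -1 <= x <= 1 ->
  0 <= ((1 - 'X) ^+ a * (1 + 'X) ^+ b : {poly R}).[x].
Proof.
move=> /andP[x1 x2]; rewrite hornerM !horner_exp !hornerE.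
by rewrite mulr_ge0// exprn_ge0//; lra.
Qed.

Lemma weight_neq0 a b : (1 - 'X) ^+ a * (1 + 'X) ^+ b != 0 :> {poly R}.
Proof.
suff : ((1 - 'X) ^+ a * (1 + 'X) ^+ b : {poly R}).[0] != 0.
  by apply: contra => /eqP ->; rewrite horner0.
by rewrite hornerM !horner_exp !hornerE ?addr0 ?subr0 ?expr1n ?mulr1 oner_neq0.
Qed.

(** The normalization at 1 requires P(1) to be nonzero: otherwise P = (x - 1) r,
    and orthogonality of P to r says that r vanishes in the weighted square norm
    with one more factor 1 - x. *)
Lemma is_jacobi_exists a b n : exists P, is_jacobi a b n P.
Proof.
have [P [P0 sP oP]] := orthogonal_below_exists ((1 - 'X) ^+ a * (1 + 'X) ^+ b) n.
have sPn : size P = n.+1.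
  apply/eqP; rewrite eqn_leq sP /= ltnNge; apply: contra P0 => Pn.
  by apply/eqP; apply: (orthogonal_below_eq0 (@weight_ge0 a b) (weight_neq0 a b) oP).
have P1 : P.[1] != 0.
  apply/eqP => P1.
  have /factor_theorem[r rE] : root P 1 by rewrite rootE P1.
  have r0 : r != 0 by apply: contra P0 => /eqP r0; rewrite rE r0 mul0r.
  have sr : (size r <= n)%N.
    by move: sP; rewrite rE size_Mmonic ?monicXsubC// size_XsubC addn2.
  have := oP _ sr; rewrite rE.
  have -> : (1 - 'X) ^+ a * (1 + 'X) ^+ b * (r * ('X - 1%:P)) * r =
    (-1) *: ((1 - 'X) ^+ a.+1 * (1 + 'X) ^+ b * r * r).
    by rewrite scaleN1r exprS polyC1; ring.
  rewrite polyintZ => /eqP; rewrite mulf_eq0 oppr_eq0 oner_eq0/= => /eqP.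
  move/(polyint_square_eq0 (@weight_ge0 _ _) (weight_neq0 _ _)) => r00.
  by rewrite r00 eqxx in r0.
exists (((\prod_(i < n) (a + 1 + i)%N%:R) / n`!%:R / P.[1]) *: P); split.
- rewrite size_scale// mulf_neq0 ?invr_eq0// mulf_neq0 ?invr_eq0 ?pnatr_eq0 -?lt0n ?fact_gt0//.
  by apply/prodf_neq0 => i _; rewrite pnatr_eq0 addn1.
- move=> q qn; rewrite Rintegral_jacobi.
  by rewrite -scalerAr -scalerAl polyintZ oP// mulr0.
- by rewrite hornerZ divfK.
Qed.

Lemma jacobiP a b n : is_jacobi a b n (jacobi R a b n).
Proof. exact: (xgetPex 0 (is_jacobi_exists a b n)). Qed.

Lemma size_jacobi a b n : size (jacobi R a b n) = n.+1.
Proof. by have [] := jacobiP a b n. Qed.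

Lemma jacobi_orthogonal a b n :
  orthogonal_below ((1 - 'X) ^+ a * (1 + 'X) ^+ b) n (jacobi R a b n).
Proof. by move=> q qn; rewrite -Rintegral_jacobi; have [_ ->] := jacobiP a b n. Qed.

(** If the integral vanished, P would be orthogonal to itself for the weight
    (1 + x)^2, because P - P(-1) is a multiple of 1 + x. *)
Lemma polyint_jacobi03_neq0 n : polyint ((1 + 'X) ^+ 2 * jacobi R 0 3 n) != 0.
Proof.
apply/eqP => C0; set P := jacobi R 0 3 n in C0.
have [r rE sr] := poly_divXadd1 P.
have : polyint ((1 - 'X) ^+ 0 * (1 + 'X) ^+ 2 * P * P) = 0.
  rewrite expr0 mul1r {2}rE mulrDr polyintD mulrC mul_polyC polyintZ C0 mulr0 add0r.
  have := jacobi_orthogonal 0 3 (n := n) (q := r); rewrite -/P.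
  rewrite expr0 mul1r => <-; last by rewrite (leq_trans sr)// size_jacobi.
  by congr polyint; rewrite !exprS; ring.
move/(polyint_square_eq0 (@weight_ge0 _ _) (weight_neq0 _ _))/(congr1 (size \o val)).
by move/eqP; rewrite /= -[_ == _]/(size P == size (0 : {poly R})) size_jacobi size_poly0.
Qed.

(** * End point values of the derivative of the facet polynomial *)
Lemma legendre_orthogonal n : orthogonal_below 1 n (legendre R n).
Proof.
by have := @jacobi_orthogonal 0 0 n; rewrite !expr0 mulr1.
Qed.

Lemma legendre1 n : (legendre R n).[1] = 1.
Proof.
have [_ _ ->] := jacobiP 0 0 n.
under eq_bigr do rewrite add0n add1n.
rewrite -natr_prod fact_prod (big_addn 0 _ 1) subn1 /= big_mkord.
under [X in _ / X%:R]eq_bigr do rewrite addn1.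
rewrite divff// pnatr_eq0 -lt0n; apply: prodn_gt0 => i; exact: ltn0Sn.
Qed.

Lemma legendre_uniq n D :
  orthogonal_below 1 n D -> (size D <= n)%N -> D = 0.
Proof.
apply: (@orthogonal_below_eq0 1); last exact: oner_neq0.
by move=> x _; rewrite hornerE.
Qed.

Lemma size_legendre n : size (legendre R n) = n.+1.
Proof. exact: size_jacobi. Qed.

Lemma polyint_compN p : polyint (p \Po - 'X) = polyint p.
Proof.
rewrite -{1}(antiderivK p).
have -> : (antideriv p)^`() \Po - 'X = (- (antideriv p \Po - 'X))^`().
  by rewrite derivN deriv_comp derivN derivX mulrN1 opprK.
by rewrite polyint_deriv !hornerN !horner_comp !hornerN !hornerX opprK
  polyint_antideriv opprK addrC.
Qed.

(** P(-x) - (-1)^n P(x) has degree less than n and inherits the orthogonality. *)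
Lemma legendreN1 n : (legendre R n).[-1] = (-1) ^+ n.
Proof.
set P := legendre R n; pose D := P \Po - 'X - (-1) ^+ n *: P.
have sNX : size (- 'X : {poly R}) = 2 by rewrite size_polyN size_polyX.
have sS : size (P \Po - 'X) = n.+1 by rewrite size_comp_poly2// size_legendre.
suff /eqP : D = 0.
  rewrite subr_eq0 => /eqP/(congr1 (fun p => p.[1])).
  by rewrite horner_comp !hornerE legendre1 mulr1.
apply: (@legendre_uniq n).
- move=> q qn; rewrite mul1r mulrBl -scalerAl -scaleNr polyintD polyintZ.
  have -> : polyint (P * q) = 0 by rewrite -[P]mul1r legendre_orthogonal.
  have -> : (P \Po - 'X) * q = (P * (q \Po - 'X)) \Po - 'X.
    rewrite comp_polyM -comp_polyA; congr (_ * _).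
    have -> : - 'X \Po - 'X = 'X :> {poly R}.
      by rewrite linearN /= comp_polyX opprK.
    by rewrite comp_polyXr.
  rewrite polyint_compN mulr0 addr0.
  by rewrite -[P]mul1r legendre_orthogonal// size_comp_poly2.
- apply/leq_sizeP => j; rewrite leq_eqVlt => /orP[/eqP <-|nj].
    rewrite coefB coefZ.
    have -> : (P \Po - 'X)`_n = lead_coef (P \Po - 'X) by rewrite lead_coefE sS.
    rewrite lead_coef_comp ?sNX// lead_coefN lead_coefX size_legendre/=.
    by rewrite [lead_coef P]lead_coefE size_legendre mulrC subrr.
  by rewrite coefB coefZ !nth_default ?sS ?size_legendre// mulr0 subr0.
Qed.

(** The left hand side has degree less than n, because the leading terms cancel,
    and two integrations by parts show that it is orthogonal to all polynomials
    of degree less than n. *)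
Lemma legendre_ode n : let P := legendre R n in
  ((1 - 'X^2) * P^`())^`() + (n * n.+1)%:R *: P = 0.
Proof.
move=> P; apply: (@legendre_uniq n).
- move=> q qn; rewrite mul1r mulrDl polyintD -scalerAl polyintZ.
  have -> : polyint (P * q) = 0 by rewrite -[P]mul1r legendre_orthogonal.
  have w1 : (1 - 'X^2 : {poly R}).[1] = 0 by rewrite !hornerE ?expr1n subrr.
  have wN1 : (1 - 'X^2 : {poly R}).[-1] = 0 by rewrite !hornerE ?sqrrN ?expr1n subrr.
  rewrite mulr0 addr0 polyint_parts !hornerM w1 wN1 !mul0r subrr sub0r.
  have -> : (1 - 'X^2) * P^`() * q^`() = P^`() * ((1 - 'X^2) * q^`()) by ring.
  rewrite polyint_parts !hornerM w1 wN1 !(mul0r, mulr0) subrr sub0r opprK.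
  rewrite -[P]mul1r legendre_orthogonal//.
  apply/leq_sizeP => j nj.
  rewrite coef_deriv mulrBl mul1r coefB coefXnM !coef_deriv.
  have q0 i : (n <= i)%N -> q`_i = 0 by move=> ni; rewrite nth_default// (leq_trans qn).
  have -> : q`_j.+2 = 0 by rewrite q0// !leqW.
  case: j nj => [|j] nj; first by rewrite mul0rn subr0 mul0rn.
  by rewrite !ltnS subSS subn1 /= q0// !mul0rn subr0 mul0rn.
- apply/leq_sizeP => j nj.
  have P0 i : (n < i)%N -> P`_i = 0 by move=> ni; rewrite nth_default// size_legendre.
  rewrite coefD coefZ coef_deriv mulrBl mul1r coefB coefXnM !coef_deriv (P0 j.+2).
  case: j nj => [|j]; first by rewrite leqn0 => /eqP ->; rewrite mul0n mul0r mul0rn subr0 mul0rn addr0.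
  rewrite !ltnS subSS subn1 /= leq_eqVlt => /orP[/eqP ->|nj]; last first.
    by rewrite P0// !mul0rn subrr mul0rn mulr0 addr0.
  by rewrite mul0rn sub0r mulNrn -mulrnA mulr_natl addrC subrr.
  by rewrite !ltnS leqW.
Qed.

(** At the end points the factor 1 - x^2 vanishes, so the differential equation
    and its derivative determine the first and the second derivative. *)
Lemma legendre_deriv2 n :
  let P := legendre R n in let N := (n * n.+1)%:R : R in
  P^`()^`().[1] = N * (N - 2) / 8 /\
  P^`()^`().[-1] = (-1) ^+ n * (N * (N - 2) / 8).
Proof.
move=> P N.
have ode := legendre_ode n; rewrite -/P in ode.
have E1 (x : R) : (1 - x^+2) * P^`()^`().[x] - 2 * x * P^`().[x] + N * P.[x] = 0.
  move/(congr1 (fun p => p.[x])) : ode; rewrite derivM !poly.derivE /= !hornerE => <-.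
  by rewrite /N; ring.
have E2 (x : R) : (1 - x^+2) * P^`()^`()^`().[x] - 4 * x * P^`()^`().[x]
    + (N - 2) * P^`().[x] = 0.
  move/(congr1 (fun p => p^`().[x])) : ode; rewrite derivD !derivM !poly.derivE /= !hornerE => <-.
  by rewrite /N /=; ring.
have L1 : P.[1] = 1 by exact: legendre1.
have LN1 : P.[-1] = (-1) ^+ n by exact: legendreN1.
move: (E1 1) (E1 (-1)) (E2 1) (E2 (-1)); rewrite sqrrN expr1n L1 LN1.
move: (P^`()^`().[1]) (P^`()^`().[-1]) (P^`().[1]) (P^`().[-1]) => a b c d.
move=> e1 e2 e3 e4; split.
  have c2 : c = N / 2 by lra.
  by rewrite c2 in e3; lra.
have d2 : d = - (N / 2) * (-1) ^+ n by lra.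
by rewrite d2 in e4; lra.
Qed.

Lemma CR_Q_deriv_at1 k : ((CR_Q R k)^`()).[1] = k%:R * (k%:R + 2) / 2.
Proof.
rewrite /CR_Q derivZ !derivB hornerZ hornerD hornerN.
have [-> _] := legendre_deriv2 k.+1; have [-> _] := legendre_deriv2 k.
rewrite !natrM -[k.+2]addn2 -addn1 !natrD.
have : (k%:R + 1 : R) != 0 by rewrite natr1 pnatr_eq0.
by move: (k%:R : R) => x ?; field.
Qed.

Lemma CR_Q_deriv_atN1 k : odd k ->
  ((CR_Q R k)^`()).[-1] = k%:R * (k%:R + 1) * (k%:R + 2) / 4.
Proof.
move=> ok; rewrite /CR_Q derivZ !derivB hornerZ hornerD hornerN.
have [_ ->] := legendre_deriv2 k.+1; have [_ ->] := legendre_deriv2 k.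
have sk : (-1) ^+ k = -1 :> R by rewrite -signr_odd ok expr1.
rewrite exprS sk !natrM -[k.+2]addn2 -addn1 !natrD.
have : (k%:R + 1 : R) != 0 by rewrite natr1 pnatr_eq0.
by move: (k%:R : R) => x ?; field.
Qed.

Lemma size_CR_Q_deriv k : (size (CR_Q R k)^`() <= k)%N.
Proof.
apply/leq_sizeP => j kj; rewrite coef_deriv /CR_Q coefZ coef_deriv coefB.
by rewrite !nth_default ?size_legendre ?ltnS// ?leqW// subrr mul0rn mulr0 mul0rn.
Qed.

End Polynomials.

(** * Barycentric coordinates *)

Section Barycentric.
Variable R : realType.
Local Notation V := 'rV[R]_3.
Implicit Types (K S F : {fset V}) (x y z v : V) (f g : V -> R).

Lemma affine_combination f I (r : seq I) (c : I -> R) (e : I -> V) :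
  affine_fun f -> \sum_(i <- r) c i = 1 ->
  f (\sum_(i <- r) c i *: e i) = \sum_(i <- r) c i * f (e i).
Proof.
case=> a [b fE] c1; rewrite fE.
under [RHS]eq_bigr do rewrite fE mulrDr.
rewrite big_split/= -mulr_suml c1 mul1r; congr (_ + _).
under [RHS]eq_bigr do rewrite mulr_sumr.
rewrite [RHS]exchange_big/=; apply: eq_bigr => i _.
rewrite summxE mulr_sumr; apply: eq_bigr => j _; rewrite mxE; ring.
Qed.

Lemma affine_convex f (u : R) x y : affine_fun f ->
  f (u *: x + (1 - u) *: y) = u * f x + (1 - u) * f y.
Proof.
case=> a [b fE]; rewrite !fE !mulrDr !mulr_sumr.
transitivity (b + \sum_i (u * (a 0 i * x 0 i) + (1 - u) * (a 0 i * y 0 i))).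
  by congr (_ + _); apply: eq_bigr => i _; rewrite !mxE; ring.
rewrite big_split/=; ring.
Qed.

(** The rows (1, v), for v a vertex, form an invertible 4 x 4 matrix M by affine
    independence; the coordinates of x are the entries of (1, x) M^-1. *)
Lemma bary_exists K : simplex 4 K -> exists L : V -> V -> R,
  [/\ forall z, affine_fun (L z),
      {in K &, forall y z, L z y = (y == z)%:R},
      forall x, \sum_(z <- K) L z x = 1
    & forall x, \sum_(z <- K) L z x *: z = x].
Proof.
move=> [sK aK]; pose s : seq V := enum_fset K.
have ss : size s = 4 by [].
have us : uniq s by exact: fset_uniq.
have sumE (W : nmodType) (G : V -> W) : \sum_(v <- K) G v = \sum_(i < 4) G s`_i.
  by rewrite (big_nth 0) -[size _]/(size s) ss big_mkord.
have inK (i : 'I_4) : s`_i \in K by rewrite -[_ \in _]/(s`_i \in s) mem_nth// ss.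
have idx (i : 'I_4) : index s`_i s = i by rewrite index_uniq// ss.
pose B : 'M[R]_(4, 3) := \matrix_(i < 4) (s`_i).
pose M : 'M[R]_(1 + 3) := row_mx (const_mx 1 : 'M[R]_(4, 1)) B.
have uB (u : 'rV[R]_4) : u *m B = \sum_(i < 4) u 0 i *: s`_i.
  by rewrite mulmx_sum_row; apply: eq_bigr => i _; rewrite rowK.
have u1 (u : 'rV[R]_4) : u *m (const_mx 1 : 'M[R]_(4, 1)) = (\sum_(i < 4) u 0 i)%:M.
  apply/matrixP => i j; rewrite !ord1 !mxE eqxx mulr1n.
  by apply: eq_bigr => k _; rewrite mxE mulr1.
have Mu : M \in unitmx.
  rewrite -row_free_unit; apply: inj_row_free => u; rewrite mul_mx_row u1 uB.
  rewrite -[RHS](@row_mx0 _ 1 1 3) => /eq_row_mx[/(congr1 (fun A : 'M[R]_1 => A 0 0)) su0 sus0].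
  rewrite !mxE eqxx mulr1n in su0.
  pose c v := if insub (index v s) is Some i then u 0 (i : 'I_4) else 0.
  have cE (i : 'I_4) : c s`_i = u 0 i by rewrite /c idx valK.
  have c0 : forall v, v \in K -> c v = 0.
    by apply: aK; rewrite sumE; under eq_bigr do rewrite cE.
  by apply/rowP => i; rewrite -cE c0// mxE.
pose N := invmx M.
pose l x : 'rV[R]_4 := row_mx 1%:M x *m N.
have lM x : l x *m M = row_mx 1%:M x by rewrite mulmxKV.
have [l1 lx] : (forall x, \sum_i l x 0 i = 1) /\ (forall x, \sum_i l x 0 i *: s`_i = x).
  split=> x; have := lM x; rewrite mul_mx_row u1 uB => /eq_row_mx[].
    by move=> /(congr1 (fun A : 'M[R]_1 => A 0 0)); rewrite !mxE eqxx !mulr1n.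
  by [].
pose L z x := l x 0 (inord (index z s)).
have LsE (i : 'I_4) x : L s`_i x = l x 0 i by rewrite /L idx inord_val.
exists L; split.
- move=> z; rewrite /L; set j := inord _.
  exists (\row_(i < 3) N (rshift 1 i) j), (N (lshift 3 0) j) => x.
  rewrite /l mxE big_split_ord/= big_ord1 row_mxEl mxE eqxx mul1r; congr (_ + _).
  by apply: eq_bigr => i _; rewrite row_mxEr mxE mulrC.
- have ind y : y \in K -> exists i : 'I_4, y = s`_i.
    move=> yK; have yi : (index y s < 4)%N by have := yK; rewrite -[_ \in K]index_mem -[size _]/(size s) ss.
    by exists (Ordinal yi); rewrite /= nth_index.
  move=> y z /ind[i ->] /ind[j ->]; rewrite LsE.
  have -> : l s`_i = row i (M *m N).
    rewrite row_mul /l; congr (_ *m _).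
    rewrite row_row_mx rowK; congr row_mx.
    by apply/rowP => k; rewrite !ord1 !mxE eqxx.
  rewrite mulmxV// !mxE; congr (_ %:R).
  by rewrite nth_uniq// ss ltn_ord.
- by move=> x; rewrite sumE; under eq_bigr do rewrite LsE.
- by move=> x; rewrite sumE; under eq_bigr do rewrite LsE.
Qed.

Lemma affine_bary_uniq K f g : simplex 4 K -> affine_fun f -> affine_fun g ->
  {in K, f =1 g} -> f =1 g.
Proof.
move=> /bary_exists[L [_ _ L1 Lx]] af ag fg x.
rewrite -(Lx x) !affine_combination//.
by apply: eq_big_seq => z /fg ->.
Qed.

Lemma bary_spec K z : simplex 4 K -> z \in K ->
  affine_fun (bary K z) /\ {in K, forall y, bary K z y = (y == z)%:R}.
Proof.
move=> sK zK; have [L [aL LK _ _]] := bary_exists sK.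
have : [set f | [/\ affine_fun f, f z = 1
                 & forall y, y \in K -> y != z -> f y = 0]] (bary K z).
  apply: (@getPex _ [set f | [/\ affine_fun f, f z = 1
                 & forall y, y \in K -> y != z -> f y = 0]]).
  exists (L z); split=> //; first by rewrite LK// eqxx.
  by move=> y yK /negPf yz; rewrite LK// yz.
case=> ab bz1 b0; split=> // y yK; have [->//|yz] := eqVneq y z.
by rewrite b0.
Qed.

Lemma affine_bary K z : simplex 4 K -> z \in K -> affine_fun (bary K z).
Proof. by move=> sK /(bary_spec sK)[]. Qed.

Lemma bary_vertex K y z : simplex 4 K -> y \in K -> z \in K ->
  bary K z y = (y == z)%:R.
Proof. by move=> sK yK /(bary_spec sK)[_ ->]. Qed.

Lemma sum_bary_point K x : simplex 4 K ->
  \sum_(z <- K) bary K z x = 1 /\ \sum_(z <- K) bary K z x *: z = x.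
Proof.
move=> sK; have [L [aL LK L1 Lx]] := bary_exists sK.
have E z : z \in K -> bary K z x = L z x.
  move=> zK; apply: (affine_bary_uniq sK) => //; first exact: affine_bary.
  by move=> y yK; rewrite bary_vertex// LK.
by split; [rewrite -[RHS](L1 x)|rewrite -[RHS](Lx x)]; apply: eq_big_seq => z /E ->.
Qed.

Lemma sum_bary K x : simplex 4 K -> \sum_(z <- K) bary K z x = 1.
Proof. by case/(@sum_bary_point _ x). Qed.

Lemma bary_point K x : simplex 4 K -> \sum_(z <- K) bary K z x *: z = x.
Proof. by case/(@sum_bary_point _ x). Qed.

Lemma affine_baryE K f x : simplex 4 K -> affine_fun f ->
  f x = \sum_(z <- K) bary K z x * f z.
Proof.
move=> sK af; rewrite -{1}(bary_point x sK) affine_combination//.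
exact: sum_bary.
Qed.

Lemma bary_sub_combination K S c z : simplex 4 K -> (S `<=` K)%fset -> z \in K ->
  \sum_(v <- S) c v = 1 ->
  bary K z (\sum_(v <- S) c v *: v) = if z \in S then c z else 0.
Proof.
move=> sK SK zK c1; rewrite affine_combination//; last exact: affine_bary.
rewrite (eq_big_seq (fun v => if v == z then c z else 0)); last first.
  move=> v vS; rewrite bary_vertex// ?(fsubsetP SK)//.
  by case: eqP => [->|]; rewrite ?mulr1 ?mulr0.
have [zS|zS] := boolP (z \in S).
  rewrite (big_fsetD1 z)//= eqxx big1_fset ?addr0// => v.
  by rewrite !inE => /andP[/negPf ->].
rewrite big1_seq// => v /= vS; case: eqP => // vz.
by rewrite -vz vS in zS.
Qed.

Lemma hull_bary K x : simplex 4 K -> hull K x <-> {in K, forall z, 0 <= bary K z x}.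
Proof.
move=> sK; split=> [[c [c0 c1 ->]] z zK|b0].
  by rewrite bary_sub_combination ?zK ?c0.
by exists (bary K ^~ x); rewrite sum_bary// bary_point.
Qed.

Lemma bary_le1 K z x : simplex 4 K -> z \in K -> hull K x -> bary K z x <= 1.
Proof.
move=> sK zK /(hull_bary _ sK) hx.
by rewrite -(sum_bary x sK) (big_fsetD1 z)//= lerDl big_seq sumr_ge0// => v;
  rewrite !inE => /andP[_ /hx].
Qed.

Lemma hull_vertex S v : v \in S -> hull S v.
Proof.
move=> vS; exists (fun u => (u == v)%:R); split.
- by move=> u _; rewrite ler0n.
- rewrite (big_fsetD1 v)//= eqxx big1_fset ?addr0// => u.
  by rewrite !inE => /andP[/negPf ->].
- rewrite (big_fsetD1 v)//= eqxx scale1r big1_fset ?addr0// => u.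
  by rewrite !inE => /andP[/negPf ->]; rewrite scale0r.
Qed.

Lemma hull_sub_bary0 K S z x : simplex 4 K -> (S `<=` K)%fset -> z \in K ->
  z \notin S -> hull S x -> bary K z x = 0.
Proof.
by move=> sK SK zK /negPf zS [c [_ c1 ->]]; rewrite bary_sub_combination// zS.
Qed.

(** This turns the inclusions between hulls in the definitions of the mesh into
    inclusions between sets of vertices. *)
Lemma vertex_hull_sub K S v : simplex 4 K -> (S `<=` K)%fset -> v \in K ->
  hull S v -> v \in S.
Proof.
move=> sK SK vK hv; apply/negPn/negP => vS.
have := hull_sub_bary0 sK SK vK vS hv.
by rewrite bary_vertex// eqxx => /eqP; rewrite oner_eq0.
Qed.

Lemma hull_subset S S' : (S `<=` S')%fset -> hull S `<=` hull S'.
Proof.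
move=> SS' x [c [c0 c1 ->]].
have sumE (W : nmodType) (G : V -> W) :
    \sum_(v <- S') (if v \in S then G v else 0) = \sum_(v <- S) G v.
  rewrite -(big_fset_incl _ SS') => [|v _ /negPf -> //].
  by apply: eq_big_seq => v vS; case: ifP => // /negP[].
exists (fun v => if v \in S then c v else 0); split.
- by move=> v _; case: ifP => // /c0.
- by rewrite sumE.
- by rewrite -[LHS]sumE; apply: eq_bigr => v _; case: ifP; rewrite // scale0r.
Qed.

Lemma opposite_vertexP K F : simplex 4 K -> facet_of K F ->
  opposite_vertex K F \in K /\ opposite_vertex K F \notin F.
Proof.
move=> [cK _] [FK cF].
have : [set` (K `\` F)%fset] (opposite_vertex K F).
  apply: (@xgetPex _ 0 [set` (K `\` F)%fset]).
  have /fset0Pn[z zKF] : (K `\` F != fset0)%fset.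
    by rewrite -cardfs_eq0 cardfsDS// cK cF.
  by exists z.
by rewrite /= inE => /andP[].
Qed.

Lemma facet_vertices K F z : simplex 4 K -> facet_of K F -> z \in K -> z \notin F ->
  F = (K `\ z)%fset.
Proof.
move=> [cK _] [FK cF] zK zF; apply/eqP; rewrite eqEfcard; apply/andP; split.
  apply/fsubsetP => v vF; rewrite !inE (fsubsetP FK)// andbT.
  by apply: contraNneq zF => <-.
have := cardfsD1 z K; by rewrite zK cK cF add1n => -[<-].
Qed.

(** Two different facets contain all four vertices, so a common plane would give
    a nonzero affine function that vanishes on the tetrahedron. *)
Lemma coplanar_facets_eq K F F' (H : set V) : simplex 4 K ->
  facet_of K F -> facet_of K F' -> plane H ->
  hull F `<=` H -> hull F' `<=` H -> F = F'.
Proof.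
move=> sK fF fF' [a [b [a0 ->]]] FH F'H; apply/eqP/negPn/negP => FF'.
have [zK zF] := opposite_vertexP sK fF; set z := opposite_vertex K F in zK zF.
have zF' : z \in F'.
  apply: contraNT FF' => zF'.
  by rewrite (facet_vertices sK fF zK zF) (facet_vertices sK fF' zK zF').
have KH y : y \in K -> \sum_i a 0 i * y 0 i = b.
  move=> yK; have [->|yz] := eqVneq y z; first by apply: F'H; exact: hull_vertex.
  apply: FH; apply: hull_vertex.
  by rewrite (facet_vertices sK fF zK zF) !inE yz.
have E : (fun x => - b + \sum_i a 0 i * x 0 i) =1 (fun _ => 0).
  apply: (affine_bary_uniq sK).
  - by exists a, (- b).
  - exists 0, 0 => x; rewrite big1 ?addr0// => i _; by rewrite mxE mul0r.
  - by move=> y /KH ->; rewrite addNr.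
have b0 : b = 0.
  have := E 0; rewrite big1 ?addr0 => [/eqP|i _]; last by rewrite mxE mulr0.
  by rewrite oppr_eq0 => /eqP.
move/eqP: a0; apply; apply/rowP => j; rewrite mxE.
have := E (delta_mx 0 j); rewrite b0 oppr0 add0r (bigD1 j)//= mxE !eqxx mulr1.
rewrite big1 ?addr0// => i ij; by rewrite mxE eqxx (negPf ij) mulr0.
Qed.

(** * Tetrahedra that share a facet or a critical edge *)

Section Mesh.
Variables (Omega : set V) (T : {fset {fset V}}).
Hypothesis HT : conforming_mesh Omega T.

Lemma mesh_simplex K : K \in T -> simplex 4 K.
Proof. by case: HT => + _ _; apply. Qed.

Lemma mesh_subset K K' S : K \in T -> K' \in T -> (S `<=` K)%fset ->
  hull S `<=` hull K' -> (S `<=` K')%fset.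
Proof.
move=> KT K'T SK SK'; apply/fsubsetP => v vS.
have [_ /(_ _ _ KT K'T)[S0 [S0K S0K' KK']] _] := HT.
have vK : v \in K by rewrite (fsubsetP SK).
apply: (fsubsetP S0K'); apply: (vertex_hull_sub (mesh_simplex KT) S0K vK).
by rewrite -KK'; split; [exact: hull_vertex|apply/SK'; exact: hull_vertex].
Qed.

Lemma mesh_facet_subset_eq K K' z F : K \in T -> K' \in T -> facet_of K F ->
  facet_of K' F -> z \in K -> z \notin F -> z \in K' -> K = K'.
Proof.
move=> KT K'T FK FK' zK zF zK'.
have e := facet_vertices (mesh_simplex KT) FK zK zF.
have e' := facet_vertices (mesh_simplex K'T) FK' zK' zF.
by rewrite -(fsetD1K zK) -e e' fsetD1K.
Qed.

(** Both coordinates vanish on F, hence are proportional.  With a nonnegative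
    factor, a point of K slightly off the centroid of F would also lie in K',
    although conformity confines the intersection of K and K' to F. *)
Lemma opposite_sides K K' F z z' : K \in T -> K' \in T -> K != K' ->
  facet_of K F -> facet_of K' F -> z \in K -> z \notin F -> z' \in K' -> z' \notin F ->
  exists2 b, b < 0 & forall x, bary K' z' x = b * bary K z x.
Proof.
move=> KT K'T KK' FK FK' zK zF zK' zF'.
have sK := mesh_simplex KT; have sK' := mesh_simplex K'T.
have eF := facet_vertices sK FK zK zF.
have eF' := facet_vertices sK' FK' zK' zF'.
have [FsK cF] := FK.
exists (bary K' z' z); last first.
  apply: (affine_bary_uniq sK); first exact: affine_bary.
    have [a [b E]] := affine_bary sK zK.
    exists (bary K' z' z *: a), (bary K' z' z * b) => x.
    rewrite E mulrDr mulr_sumr; congr (_ + _).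
    by apply: eq_bigr => i _; rewrite mxE mulrA.
  move=> y yK; have [->|yz] := eqVneq y z; first by rewrite [bary K z z]bary_vertex// eqxx mulr1.
  have yF : y \in F by rewrite eF !inE yz.
  rewrite bary_vertex// ?(fsubsetP FK'.1)// [bary K z y]bary_vertex// (negPf yz) mulr0.
  by case: eqP => // yz'; rewrite -yz' yF in zF'.
rewrite ltNge; apply/negP => b_ge0.
pose M := \sum_(y <- F) `|bary K' y z|.
have M0 : 0 <= M by apply: sumr_ge0.
(* The point x has coordinate e at z and (1 - e) / 3 at the vertices of F; this
   e makes (1 - e) / 3 equal to e * M, enough to outweigh the coordinates of z
   with respect to K'. *)
pose e := (1 + 3 * M)^-1.
have e0 : 0 < e by rewrite invr_gt0; lra.
have eM : e * (1 + 3 * M) = 1 by rewrite mulVf//; apply: lt0r_neq0; lra.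
pose c v := if v == z then e else (1 - e) / 3.
have c_ge0 v : 0 <= c v.
  rewrite /c; case: ifP => _; first exact: ltW.
  have : e <= e * (1 + 3 * M) by rewrite ler_pMr//; lra.
  by rewrite eM; lra.
have sumE (W : nmodType) (G : V -> W) : \sum_(v <- K) G v = G z + \sum_(v <- F) G v.
  by rewrite (big_fsetD1 z)//= -eF.
have cFE v : v \in F -> c v = (1 - e) / 3.
  by rewrite /c; case: eqP => // -> zF2; rewrite zF2 in zF.
have sum3 (r : R) : \sum_(v <- F) r = 3 * r.
  by rewrite big_const_seq count_predT -[size _]/#|`F| cF iter_addr_0 mulr_natl.
have c1 : \sum_(v <- K) c v = 1.
  rewrite sumE (eq_big_seq _ cFE) sum3 /c eqxx; lra.
pose x := \sum_(v <- K) c v *: v.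
have bx y : y \in K' -> bary K' y x = e * bary K' y z + \sum_(v <- F) (1 - e) / 3 * bary K' y v.
  move=> yK'; rewrite affine_combination//; last exact: affine_bary.
  rewrite sumE.
  rewrite {1}/c eqxx; congr (_ + _); by apply: eq_big_seq => v /cFE ->.
have hK : hull K x by exists c; split.
have hK' : hull K' x.
  apply/(hull_bary _ sK') => y yK'; rewrite bx//.
  have [->|yz'] := eqVneq y z'.
    rewrite big1_seq ?addr0 ?mulr_ge0// ?ltW// => v /= vF.
    rewrite bary_vertex// ?(fsubsetP FK'.1)//.
    by case: eqP => [vz|]; rewrite ?mulr0//; rewrite -vz vF in zF'.
  have yF : y \in F by rewrite eF' !inE yz'.
  rewrite (big_fsetD1 y)//= big1_seq ?addr0; last first.
    move=> v /=; rewrite !inE => /andP[/negPf vy vF].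
    by rewrite bary_vertex ?vy ?mulr0// (fsubsetP FK'.1).
  rewrite [bary K' y y]bary_vertex// eqxx mulr1.
  have : `|bary K' y z| <= M.
    by rewrite /M (big_fsetD1 y)//= lerDl sumr_ge0.
  rewrite ler_norml => /andP[hM _].
  have : e * - M <= e * bary K' y z by rewrite ler_pM2l.
  by lra.
have [_ /(_ _ _ KT K'T)[S0 [S0K S0K' E]] _] := HT.
have zS0 : z \notin S0.
  apply: contra KK' => zS0; apply/eqP.
  by apply: (mesh_facet_subset_eq KT K'T FK FK' zK zF); exact: (fsubsetP S0K').
have hS : hull S0 x by rewrite -E.
have := hull_sub_bary0 sK S0K zK zS0 hS.
by rewrite bary_sub_combination// zK /c eqxx => e00; rewrite e00 ltxx in e0.
Qed.

(** Three tetrahedra at F would give three pairwise negative factors in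
    [opposite_sides], but the third factor is the product of the other two. *)
Lemma facet_shared_by_two K1 K2 K3 F : K1 \in T -> K2 \in T -> K3 \in T ->
  facet_of K1 F -> facet_of K2 F -> facet_of K3 F ->
  K1 != K2 -> K1 != K3 -> K2 != K3 -> False.
Proof.
move=> T1 T2 T3 F1 F2 F3 n12 n13 n23.
have [z1 f1] := opposite_vertexP (mesh_simplex T1) F1.
have [z2 f2] := opposite_vertexP (mesh_simplex T2) F2.
have [z3 f3] := opposite_vertexP (mesh_simplex T3) F3.
have [b12 b12_lt0 e12] := opposite_sides T1 T2 n12 F1 F2 z1 f1 z2 f2.
have [b13 b13_lt0 e13] := opposite_sides T1 T3 n13 F1 F3 z1 f1 z3 f3.
have [b23 b23_lt0 e23] := opposite_sides T2 T3 n23 F2 F3 z2 f2 z3 f3.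
have := e23 (opposite_vertex K1 F); rewrite e12 e13 bary_vertex//; last exact: mesh_simplex.
rewrite eqxx !mulr1 => b13E.
have : 0 < b23 * b12 by rewrite nmulr_rgt0.
by rewrite -b13E; lra.
Qed.

Variables (E : {fset V}) (Ks : seq {fset V}).
Hypotheses (HE : critical T E) (HKs : star_numbering Omega T E Ks).

Local Notation Kn := (nth fset0 Ks).

Lemma star_mem K : K \in Ks <-> K \in T /\ (E `<=` K)%fset.
Proof.
have [_ KsE _ _] := HKs; have [[K0 K0T [EK0 _]] _] := HE.
have -> : (K \in Ks) = ([set` Ks] K) :> Prop by [].
rewrite KsE; split=> -[KT h]; split=> //; last exact: hull_subset.
exact: (mesh_subset K0T KT EK0 h).
Qed.

(** The colour of a facet tells in which of the two planes it lies. *)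
Lemma critical_coloring : exists col : {fset V} -> bool, forall K F F',
  K \in T -> facet_of K F -> facet_of K F' -> (E `<=` F)%fset -> (E `<=` F')%fset ->
  F != F' -> col F' = ~~ col F.
Proof.
have [_ [H1 [H2 [pH1 pH2 H12]]]] := HE.
exists (fun F => `[< hull F `<=` H1 >]) => K F F' KT FK FK' EF EF' FF'.
have sK := mesh_simplex KT.
have fF : facet T F by exists K.
have fF' : facet T F' by exists K.
case: asboolP => h'; case: asboolP => h //=.
  by rewrite (coplanar_facets_eq sK FK FK' pH1) ?eqxx in FF'.
case: (H12 _ fF (hull_subset EF)) => // g.
case: (H12 _ fF' (hull_subset EF')) => // g'.
by rewrite (coplanar_facets_eq sK FK FK' pH2) ?eqxx in FF'.
Qed.

(** Consecutive facets along the chain from the i-th to the j-th tetrahedron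
    alternate in colour, and F closes the chain to a cycle of j - i + 1 facets,
    whose length must be even. *)
Lemma neighbours_opposite_parity F i j : (i < j < size Ks)%N ->
  facet_of (Kn i) F -> facet_of (Kn j) F -> (E `<=` F)%fset -> odd (j - i).
Proof.
move=> /andP[ij js] Fi Fj EF.
have [uKs _ adj _] := HKs; have [col colP] := critical_coloring.
have KnT l : (l < size Ks)%N -> Kn l \in T.
  by move=> ls; have [] := (star_mem (Kn l)).1 (mem_nth _ ls).
have KnE l : (l < size Ks)%N -> (E `<=` Kn l)%fset.
  by move=> ls; have [] := (star_mem (Kn l)).1 (mem_nth _ ls).
have neqK l m : (l < m < size Ks)%N -> Kn l != Kn m.
  move=> /andP[lm ms]; rewrite nth_uniq// ?(ltn_trans lm)//.
  by rewrite neq_ltn lm.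
pose Fn l := (Kn l `&` Kn l.+1)%fset.
have FnP l : (l.+1 < size Ks)%N ->
    [/\ facet_of (Kn l) (Fn l), facet_of (Kn l.+1) (Fn l) & (E `<=` Fn l)%fset].
  move=> ls; have ls' := ltnW ls; have [G [GK cG] [GK' _]] := adj _ ls.
  have cFn : #|` Fn l| = 3.
    have [c1 _] := mesh_simplex (KnT _ ls'); have [c2 _] := mesh_simplex (KnT _ ls).
    have le3 : (3 <= #|` Fn l|)%N.
      have /fsubset_leq_card : (G `<=` Fn l)%fset by rewrite fsubsetI GK.
      by rewrite cG.
    apply/eqP; rewrite eqn_leq le3 andbT -ltnS.
    have : (#|` Fn l| <= #|` Kn l|)%N by rewrite fsubset_leq_card ?fsubsetIl.
    rewrite c1 leq_eqVlt => /orP[cE|//]; exfalso; move: cE; apply/negP.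
    apply: contra (neqK l l.+1 _); last by rewrite ltnSn.
    move=> cE; have /eqP FnE : Fn l == Kn l by rewrite eqEfcard fsubsetIl/= (eqP cE) c1.
    rewrite eqEfcard c1 c2 leqnn andbT -FnE; exact: fsubsetIr.
  by split; [split=> //; exact: fsubsetIl|split=> //; exact: fsubsetIr|rewrite fsubsetI !KnE].
have chain l : (i + l < j)%N -> col (Fn (i + l)%N) = odd l (+) col (Fn i).
  elim: l => [|l IH] il; first by rewrite addn0.
  rewrite addnS in il *.
  have ilj := ltnW il.
  have s2 : ((i + l)%N.+2 < size Ks)%N by exact: leq_ltn_trans il js.
  have [f1 f2 e1] := FnP _ (ltnW s2); have [g1 g2 e2] := FnP _ s2.
  rewrite (colP _ _ _ (KnT _ (ltnW s2)) f2 g1 e1 e2) ?IH//= ?addNb//.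
  apply/eqP => FF; rewrite -FF in g2.
  apply: (@facet_shared_by_two (Kn (i + l)%N) (Kn (i + l)%N.+1) (Kn (i + l)%N.+2) (Fn (i + l)%N)) => //.
  - by rewrite KnT// ltnW// ltnW.
  - by rewrite KnT// ltnW.
  - by rewrite KnT.
  - by rewrite neqK// ltnSn ltnW.
  - by rewrite neqK// s2 andbT leqW.
  - by rewrite neqK// ltnSn.
have [ji|ji] := leqP j i.+1.
  have -> : j = i.+1 by apply/eqP; rewrite eqn_leq ji.
  by rewrite subSn// subnn.
have is1 : (i.+1 < size Ks)%N by exact: ltn_trans ji js.
have is0 := ltnW is1.
case: j ij js Fj ji chain => // j ij js Fj ji chain; rewrite ltnS in ji.
have js' := ltnW js.
have [f1 f2 e1] := FnP i is1; have [g1 g2 e2] := FnP j js.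
have c1 : col F = ~~ col (Fn i).
  apply: (colP _ _ _ (KnT _ is0)) => //; apply/eqP => FF; rewrite -FF in Fj.
  apply: (@facet_shared_by_two (Kn i) (Kn i.+1) (Kn j.+1) (Fn i)); rewrite ?KnT ?neqK//.
  - by rewrite ltnSn.
  - by rewrite ltnS ltnW.
  - by rewrite ltnS ji.
have c2 : col F = ~~ col (Fn j).
  apply: (colP _ _ _ (KnT _ js)) => //; apply/eqP => FF; rewrite -FF in Fi.
  apply: (@facet_shared_by_two (Kn i) (Kn j) (Kn j.+1) (Fn j)); rewrite ?KnT ?neqK//.
  - by rewrite ji.
  - by rewrite ltnS ltnW.
  - by rewrite ltnSn.
have := chain (j - i)%N; rewrite subnKC ?(ltnW ji)// => /(_ (ltnSn _)).
rewrite subSn ?(ltnW ji)//=; move: c2; rewrite c1.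
by case: (col (Fn i)); case: (col (Fn j)); case: odd.
Qed.

End Mesh.
End Barycentric.

(** * Lebesgue measure under homotheties *)

Section ProductScaling.
Context d1 d2 (T1 : measurableType d1) (T2 : measurableType d2) (R : realType).
Variable m1 : {measure set T1 -> \bar R}.
Variable m2 : {sigma_finite_measure set T2 -> \bar R}.

Lemma integral_scaling (phi : T1 -> T1) (a : R) (f : T1 -> \bar R) (D : set T1) :
  0 <= a -> measurable_fun setT phi ->
  (forall A, measurable A -> m1 (phi @^-1` A) = a%:E * m1 A)%E ->
  measurable D -> measurable_fun D f -> (forall x, D x -> (0 <= f x)%E) ->
  (\int[m1]_(x in phi @^-1` D) f (phi x) = a%:E * \int[m1]_(x in D) f x)%E.
Proof.
move=> a0 mphi hphi mD mf f0.
rewrite -[LHS](@ge0_integral_pushforward _ _ _ _ _ _ mphi m1 D f)//; last first.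
  by move=> x; rewrite inE; exact: f0.
rewrite -[a]/((NngNum a0)%:num) -ge0_integral_mscale//.
by apply: eq_measure_integral => A mA _; rewrite /= /pushforward hphi.
Qed.

Lemma product_scaling (phi : T1 -> T1) (psi : T2 -> T2) (a b : R) :
  0 <= a -> 0 <= b -> measurable_fun setT phi ->
  (forall A, measurable A -> m1 (phi @^-1` A) = a%:E * m1 A)%E ->
  (forall A, measurable A -> m2 (psi @^-1` A) = b%:E * m2 A)%E ->
  forall A, measurable A ->
    ((m1 \x m2) ((fun z => (phi z.1, psi z.2)) @^-1` A) = (a * b)%:E * (m1 \x m2) A)%E.
Proof.
move=> a0 b0 mphi h1 h2 A mA; rewrite /product_measure1.
transitivity (\int[m1]_x (b%:E * m2 (xsection A (phi x))))%E.
  apply: eq_integral => x _ /=; rewrite -h2; last exact: measurable_xsection.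
  by congr (m2 _); rewrite /xsection; apply/seteqP; split=> y /=; rewrite !inE.
have mx : measurable_fun setT (m2 \o xsection A) by exact: measurable_fun_xsection.
rewrite ge0_integralZl//; last exact: (measurableT_comp mx mphi).
rewrite -[setT in LHS](preimage_setT phi).
rewrite (@integral_scaling phi a (m2 \o xsection A) setT)//.
by rewrite muleA -EFinM mulrC.
Qed.

End ProductScaling.

Section Leb3.
Variable R : realType.

Lemma lebesgue_scaling (c b : R) (A : set R) : 0 < c -> measurable A ->
  (lebesgue_measure ((fun y : R => c * y + b)%R @^-1` A) = c^-1%R%:E * lebesgue_measure A)%E.
Proof.
move=> c0 mA.
pose phi (y : measurableTypeR R) : measurableTypeR R := c * y + b.
have mphi : measurable_fun setT phi.
  by apply: measurable_funD => //; apply: measurable_funM.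
have c0' : 0 <= c by exact: ltW.
pose mu := mscale (NngNum c0')
  (measure_function_pushforward__canonical__measure_function_Measure
     (@lebesgue_measure R) mphi).
suff -> : lebesgue_measure A = mu A.
  by rewrite /mu /= /mscale /= muleA -EFinM mulVf ?lt0r_neq0// mul1e.
apply: lebesgue_measure_unique => // _ [[x y] _ <-].
rewrite /mu /= /mscale /= -[pushforward _ _ _]/(lebesgue_measure (phi @^-1` [set` `]x, y]])).
have -> : phi @^-1` [set` `]x, y]] = [set` `](x - b) / c, (y - b) / c]].
  apply/seteqP; split=> t /=; rewrite !in_itv/= /phi ltr_pdivrMr// ler_pdivlMr// [t * c]mulrC => /andP[? ?];
  by apply/andP; split; lra.
rewrite !lebesgue_measure_itv/= !lte_fin ltr_pM2r ?invr_gt0// ltrD2r.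
case: ifP => _; last by rewrite mule0.
rewrite -!EFinB -EFinM; congr EFin.
by field; exact: lt0r_neq0.
Qed.

Definition homothety3 (c : R) (b : R * R * R) (x : R * R * R) : R * R * R :=
  (c * x.1.1 + b.1.1, c * x.1.2 + b.1.2, c * x.2 + b.2).

Lemma measurable_homothety3 c b :
  measurable_fun setT (homothety3 c b :
    measurableTypeR R * measurableTypeR R * measurableTypeR R ->
    measurableTypeR R * measurableTypeR R * measurableTypeR R).
Proof.
have maff (e : R) : measurable_fun setT (fun y : R => c * y + e).
  by apply: measurable_funD => //; apply: measurable_funM.
apply: measurable_fun_pair.
  apply: measurable_fun_pair.
  - exact: (measurableT_comp (maff _) (measurableT_comp measurable_fst measurable_fst)).
  - exact: (measurableT_comp (maff _) (measurableT_comp measurable_snd measurable_fst)).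
exact: (measurableT_comp (maff _) measurable_snd).
Qed.

Lemma leb3_homothety c b A : 0 < c -> measurable A ->
  (leb3 (homothety3 c b @^-1` A) = (c^-1 ^+ 3)%R%:E * leb3 A)%E.
Proof.
move=> c0 mA.
have ci0 : 0 <= c^-1 by rewrite invr_ge0 ltW.
have maff (e : R) : measurable_fun setT (fun y : R => c * y + e).
  by apply: measurable_funD => //; apply: measurable_funM.
pose phi2 (x : R * R) := (c * x.1 + b.1.1, c * x.2 + b.1.2).
have := @product_scaling _ _ _ _ R (@lebesgue_measure R \x @lebesgue_measure R)%E
  (@lebesgue_measure R) phi2 (fun y => c * y + b.2) (c^-1 * c^-1) (c^-1).
move=> H; rewrite /leb3 [LHS]H //; last 4 first.
- by rewrite mulr_ge0.
- apply: measurable_fun_pair.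
  + exact: (measurableT_comp (maff _) measurable_fst).
  + exact: (measurableT_comp (maff _) measurable_snd).
- move=> B mB; 
  have := @product_scaling _ _ _ _ R (@lebesgue_measure R) (@lebesgue_measure R)
    (fun y => c * y + b.1.1) (fun y => c * y + b.1.2) _ _ ci0 ci0 (maff _).
  apply=> // C mC; exact: lebesgue_scaling.
- move=> C mC; exact: lebesgue_scaling.
by congr (_%:E * _)%E; ring.
Qed.

End Leb3.

(** * Measurability and integrals on a tetrahedron *)

Section Space.
Variable R : realType.
Local Notation V := 'rV[R]_3.
Local Notation X := (measurableTypeR R * measurableTypeR R * measurableTypeR R)%type.
Implicit Types (K S F : {fset V}) (x y z v : V) (f g : V -> R).

Definition to_coords (x : V) : R * R * R := (x 0 0, x 0 1, x 0 2%:R).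

Lemma of_coords_homothety c (b : V) (t : R * R * R) :
  of_coords (homothety3 c (to_coords b) t) = c *: of_coords t + b.
Proof.
apply/rowP => i; rewrite !mxE.
by case: i => -[|[|[|//]]] /= h; congr (_ + b _ _); apply/val_inj.
Qed.

Definition space_measurable f := measurable_fun setT (fun t : X => f (of_coords t)).

Lemma measurable_affine f : affine_fun f -> space_measurable f.
Proof.
move=> [a [b fE]]; rewrite /space_measurable; under eq_fun do rewrite fE.
apply: measurable_funD => //; apply: measurable_sum => i.
apply: measurable_funM => //.
have m11 : measurable_fun setT (fun t : X => t.1.1).
  exact: (measurableT_comp measurable_fst measurable_fst).
have m12 : measurable_fun setT (fun t : X => t.1.2).
  exact: (measurableT_comp measurable_snd measurable_fst).
have m2 : measurable_fun setT (fun t : X => t.2) by exact: measurable_snd.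
rewrite /of_coords; under eq_fun do rewrite mxE.
by case: i => -[|[|[|//]]] h.
Qed.

Lemma measurable_halfspace f (a : R) : affine_fun f ->
  measurable [set t : X | a <= f (of_coords t)].
Proof.
move=> /measurable_affine mf.
have -> : [set t : X | a <= f (of_coords t)] = (fun t : X => f (of_coords t)) @^-1` `[a, +oo[%classic.
  by apply/seteqP; split=> t /=; rewrite in_itv/= andbT.
by rewrite -[X in measurable X]setTI; exact: mf.
Qed.

Definition coords_of (A : set V) : set X := @of_coords R @^-1` A.

Lemma measurable_hull K : simplex 4 K -> measurable (coords_of (hull K)).
Proof.
move=> sK.
have -> : coords_of (hull K) = \bigcap_(z in [set` K]) [set t : X | 0 <= bary K z (of_coords t)].
  by apply/seteqP; split=> t; [move/(hull_bary _ sK)|move=> h; apply/(hull_bary _ sK)].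
apply: fin_bigcap_measurable; first exact: finite_fset.
by move=> z zK; apply: measurable_halfspace; exact: affine_bary.
Qed.

Lemma hull_coord_bounded K : exists M : R, forall x i, hull K x -> `|x 0 i| <= M.
Proof.
exists (\sum_(v <- K) \sum_i `|v 0 i|) => x i [c [c0 c1 ->]].
rewrite summxE (le_trans (ler_norm_sum _ _ _))//.
rewrite [leLHS]big_seq [leRHS]big_seq; apply: ler_sum => v vK.
have c_le1 : c v <= 1.
  rewrite -c1 (big_fsetD1 v)//= lerDl big_seq sumr_ge0// => u.
  by rewrite !inE => /andP[_ /c0].
rewrite mxE normrM ger0_norm ?c0//.
rewrite (@le_trans _ _ `|v 0 i|)// ?ler_piMl//.
by rewrite (bigD1 i)//= lerDl sumr_ge0.
Qed.

Lemma leb3_box (a b : R) : a <= b ->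
  leb3 ((`[a, b] `*` `[a, b]) `*` `[a, b])%classic = ((b - a) ^+ 3)%:E.
Proof.
move=> ab.
have E : lebesgue_measure `[a, b]%classic = (b - a)%:E :> \bar R.
  rewrite lebesgue_measure_itv/= lte_fin lt_neqAle ab andbT -EFinB.
  by case: eqVneq => [->|]; rewrite ?subrr.
rewrite /leb3 product_measure1E//; last exact: measurableX.
rewrite [X in (X * _)%E]product_measure1E//.
transitivity ((b - a)%:E * (b - a)%:E * (b - a)%:E)%E.
  by congr (_ * _ * _)%E; exact: E.
by rewrite -!EFinM; congr EFin; ring.
Qed.

Lemma leb3_hull_fin K : simplex 4 K -> (leb3 (coords_of (hull K)) < +oo)%E.
Proof.
move=> sK; have [M hM] := hull_coord_bounded K.
have MM : - `|M| <= `|M| by rewrite ge0_cp.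
pose I := `[- `|M|, `|M|]%classic.
apply: (@le_lt_trans _ _ (leb3 ((I `*` I) `*` I))); last by rewrite leb3_box// ltry.
  apply: le_measure; rewrite ?inE; first exact: measurable_hull.
    have mI : measurable (I : set (measurableTypeR R)) by exact: measurable_itv.
    exact: measurableX (measurableX mI mI) mI.
  move=> t tK.
  have hi i : - `|M| <= of_coords t 0 i <= `|M|.
    by rewrite -ler_norml (le_trans (hM _ i tK))// ler_norm.
  split; [split|]; rewrite /I /= in_itv/=.
  - by have := hi 0; rewrite mxE.
  - by have := hi 1; rewrite mxE.
  - by have := hi 2%:R; rewrite mxE.
Qed.

End Space.

Section Integral3.
Variable R : realType.
Local Notation V := 'rV[R]_3.
Local Notation X := (measurableTypeR R * measurableTypeR R * measurableTypeR R)%type.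
Variable K : {fset V}.
Hypothesis sK : simplex 4 K.
Implicit Types (f g : V -> R) (D : set V).

(** A class of integrands that is closed under ring operations, contains the
    affine functions and is integrable on every measurable part of K. *)
Definition tame f := space_measurable f /\ exists M : R, forall x, hull K x -> `|f x| <= M.

Lemma tame_cst (c : R) : tame (fun=> c).
Proof. by split; [exact: measurable_cst|exists `|c|]. Qed.

Lemma tameD f g : tame f -> tame g -> tame (fun x => f x + g x).
Proof.
move=> [mf [M hM]] [mg [N hN]]; split; first exact: measurable_funD.
by exists (M + N) => x xK; rewrite (le_trans (ler_normD _ _))// lerD// ?hM ?hN.
Qed.

Lemma tameM f g : tame f -> tame g -> tame (fun x => f x * g x).
Proof.
move=> [mf [M hM]] [mg [N hN]]; split; first exact: measurable_funM.
by exists (M * N) => x xK; rewrite normrM ler_pM ?hM ?hN.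
Qed.

Lemma tame_sum (I : eqType) (r : seq I) (F : I -> V -> R) :
  (forall i, i \in r -> tame (F i)) -> tame (fun x => \sum_(i <- r) F i x).
Proof.
elim: r => [_|i r IH tF]; first by under eq_fun do rewrite big_nil; exact: tame_cst.
under eq_fun do rewrite big_cons; apply: tameD; first by apply: tF; rewrite mem_head.
by apply: IH => j jr; apply: tF; rewrite inE jr orbT.
Qed.

Lemma tame_bary z : z \in K -> tame (bary K z).
Proof.
move=> zK; split; first by apply: measurable_affine; exact: affine_bary.
exists 1 => x hx; rewrite ger0_norm ?bary_le1//.
by move/(hull_bary _ sK): hx; apply.
Qed.

Lemma tameX f n : tame f -> tame (fun x => f x ^+ n).
Proof.
move=> tf; elim: n => [|n IH]; first exact: (tame_cst 1).
by under eq_fun do rewrite exprS; exact: tameM.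
Qed.

Lemma tame_horner (p : {poly R}) f : tame f -> tame (fun x => p.[f x]).
Proof.
move=> tf; under eq_fun do rewrite horner_coef.
by apply: tame_sum => i _; apply: tameM; [exact: tame_cst|exact: tameX].
Qed.

Lemma tame_affine f : affine_fun f -> tame f.
Proof.
move=> af; have -> : f = fun x => \sum_(z <- K) bary K z x * f z.
  by apply/funext => x; exact: affine_baryE.
by apply: tame_sum => z zK; apply: tameM; [exact: tame_bary|exact: tame_cst].
Qed.

Lemma tame_onem_bary z : z \in K -> tame (fun x => 1 - bary K z x).
Proof.
move=> zK; have -> : (fun x => 1 - bary K z x) = (fun x => 1 + (- 1) * bary K z x).
  by apply/funext => x; rewrite mulN1r.
by apply: tameD; [exact: tame_cst|apply: tameM; [exact: tame_cst|exact: tame_bary]].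
Qed.

Lemma tame_poly_affine (p : {poly R}) f : affine_fun f -> tame (fun x => p.[1 - 2 * f x]).
Proof.
move=> /tame_affine tf; apply: tame_horner.
have -> : (fun x => 1 - 2 * f x) = (fun x => 1 + (- 2) * f x).
  by apply/funext => x; rewrite mulNr.
by apply: tameD; [exact: tame_cst|apply: tameM => //; exact: tame_cst].
Qed.

Lemma tame_integrable D f : measurable (coords_of D) -> D `<=` hull K -> tame f ->
  (@leb3 R).-integrable (coords_of D) (EFin \o (fun t => f (of_coords t))).
Proof.
move=> mD DK [mf [M hM]]; apply: measurable_bounded_integrable => //.
- apply: (@le_lt_trans _ _ (leb3 (coords_of (hull K)))); last exact: leb3_hull_fin.
  apply: le_measure; rewrite ?inE//; first exact: measurable_hull.
  by move=> t; exact: DK.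
- exact: measurable_funTS.
- exists M; split; first exact: num_real.
  by move=> N MN t Dt; exact: le_trans (hM _ (DK _ Dt)) (ltW MN).
Qed.

Lemma tame_integrable_hull f : tame f ->
  (@leb3 R).-integrable (coords_of (hull K)) (EFin \o (fun t => f (of_coords t))).
Proof. by apply: tame_integrable; [exact: measurable_hull|]. Qed.

Lemma integral3D f g : tame f -> tame g ->
  integral3 (hull K) (fun x => f x + g x) = integral3 (hull K) f + integral3 (hull K) g.
Proof.
move=> tf tg; rewrite /integral3 RintegralD//; first exact: measurable_hull.
- exact: tame_integrable_hull.
- exact: tame_integrable_hull.
Qed.

Lemma integral3Zl (c : R) f : tame f ->
  integral3 (hull K) (fun x => c * f x) = c * integral3 (hull K) f.
Proof.
move=> tf; rewrite /integral3 RintegralZl//; first exact: measurable_hull.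
exact: tame_integrable_hull.
Qed.

Lemma integral3_cst0 D : integral3 D (fun=> 0) = 0.
Proof. by rewrite /integral3 /Rintegral integral0. Qed.

Lemma integral3_sum (I : eqType) (r : seq I) (F : I -> V -> R) :
  (forall i, i \in r -> tame (F i)) ->
  integral3 (hull K) (fun x => \sum_(i <- r) F i x) = \sum_(i <- r) integral3 (hull K) (F i).
Proof.
elim: r => [_|i r IH tF].
  by under eq_fun do rewrite big_nil; rewrite big_nil integral3_cst0.
have tr : forall j, j \in r -> tame (F j) by move=> j jr; apply: tF; rewrite inE jr orbT.
under eq_fun do rewrite big_cons.
rewrite big_cons integral3D ?IH//; last exact: tame_sum.
by apply: tF; rewrite mem_head.
Qed.

Lemma eq_integral3 D f g : (forall x, D x -> f x = g x) -> integral3 D f = integral3 D g.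
Proof. by move=> fg; apply: eq_Rintegral => t; rewrite inE => Dt; rewrite fg. Qed.

Lemma le_integral3 D f g : measurable (coords_of D) -> D `<=` hull K ->
  tame f -> tame g -> (forall x, D x -> f x <= g x) -> integral3 D f <= integral3 D g.
Proof.
move=> mD DK tf tg fg; apply: le_Rintegral => //; [exact: tame_integrable..|].
by move=> t; exact: fg.
Qed.

Lemma volumeE : volume (hull K) = integral3 (hull K) (fun=> 1).
Proof.
by rewrite /integral3 Rintegral_cst ?mul1r//; exact: measurable_hull.
Qed.

(** * Moments of barycentric coordinates *)

Section Cut.
Variables (b : V) (bK : b \in K).

Lemma bary_homothety (u : R) z x : z \in K ->
  bary K z (u *: x + (1 - u) *: b) = u * bary K z x + (1 - u) * (b == z)%:R.
Proof.
by move=> zK; rewrite affine_convex ?(bary_vertex sK bK zK)//; exact: affine_bary.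
Qed.

(** The image of K under the homothety with centre b and ratio u. *)
Definition cut (u : R) : set V := [set x | hull K x /\ 1 - u <= bary K b x].

Lemma measurable_cut u : measurable (coords_of (cut u)).
Proof.
have -> : coords_of (cut u) = coords_of (hull K) `&` [set t | 1 - u <= bary K b (of_coords t)].
  by [].
apply: measurableI; first exact: measurable_hull.
by apply: measurable_halfspace; exact: affine_bary.
Qed.

Lemma cut_preimage u x : 0 < u <= 1 -> cut u (u *: x + (1 - u) *: b) <-> hull K x.
Proof.
move=> /andP[u0 u1]; split.
  move=> [/(hull_bary _ sK) h1 h2]; apply/(hull_bary _ sK) => z zK.
  rewrite -(pmulr_rge0 _ u0).
  have := h1 z zK; rewrite bary_homothety//.
  case: eqVneq => [bz _|_]; last by rewrite mulr0 addr0.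
  by move: h2; rewrite bary_homothety// eqxx -bz mulr1 lerDr.
move=> /(hull_bary _ sK) h; split; last first.
  by rewrite bary_homothety// eqxx mulr1 lerDr mulr_ge0// ?h// ltW.
apply/(hull_bary _ sK) => z zK; rewrite bary_homothety// addr_ge0// mulr_ge0//.
- exact: ltW.
- exact: h.
- by rewrite subr_ge0.
Qed.

Lemma fineZ (c : R) (x : \bar R) : 0 < c -> fine (c%:E * x)%E = c * fine x.
Proof.
move=> c0; case: x => [r||] //=.
- by rewrite gt0_muley ?lte_fin// mulr0.
- by rewrite gt0_muleNy ?lte_fin// mulr0.
Qed.

Lemma integral3_cut (u : R) f : 0 < u <= 1 -> tame f -> (forall x, hull K x -> 0 <= f x) ->
  integral3 (cut u) f =
  u ^+ 3 * integral3 (hull K) (fun x => f (u *: x + (1 - u) *: b)).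
Proof.
move=> u01 [mf _] f0; have /andP[u0 u1] := u01.
have mD := measurable_cut u.
pose phi := homothety3 u (to_coords ((1 - u) *: b)).
have phiE t : of_coords (phi t) = u *: of_coords t + (1 - u) *: b.
  exact: of_coords_homothety.
have mphi : measurable_fun setT (phi : X -> X) by exact: measurable_homothety3.
have pre : phi @^-1` coords_of (cut u) = coords_of (hull K).
  by apply/seteqP; split=> t; rewrite /coords_of /preimage /= phiE => /(cut_preimage _ u01).
have ui0 : 0 <= u^-1 ^+ 3 by rewrite exprn_ge0// invr_ge0 ltW.
have H := @integral_scaling _ X R (@leb3 R) phi (u^-1 ^+ 3)
  (fun t => (f (of_coords t))%:E) (coords_of (cut u)) ui0 mphi.
rewrite /integral3 /Rintegral.
have -> : (\int[@leb3 R]_(t in @of_coords R @^-1` hull K) (f (u *: of_coords t + (1 - u) *: b))%:E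
  = (u^-1 ^+ 3)%:E * \int[@leb3 R]_(t in @of_coords R @^-1` cut u) (f (of_coords t))%:E)%E.
  rewrite -H//.
  - by rewrite pre; apply: eq_integral => t _; rewrite phiE.
  - by move=> A mA; exact: leb3_homothety.
  - by apply/measurable_EFinP; exact: measurable_funTS.
  - by move=> t [ht _]; rewrite lee_fin f0.
rewrite fineZ ?exprn_gt0 ?invr_gt0// mulrA -exprMn divff ?gt_eqF//.
by rewrite expr1n mul1r.
Qed.

Lemma integral3_split (u : R) f : tame f ->
  integral3 (hull K) f = integral3 (cut u) f + integral3 (hull K `\` cut u) f.
Proof.
move=> tf; rewrite /integral3.
have E : coords_of (hull K) = coords_of (cut u) `|` coords_of (hull K `\` cut u).
  apply/seteqP; split=> t; last by case=> [[]|[]].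
  by move=> ht; have [h|h] := pselect (cut u (of_coords t)); [left|right].
rewrite -[X in Rintegral _ X _ = _]/(coords_of (hull K)) E Rintegral_setU//.
- exact: measurable_cut.
- by apply: measurableD; [exact: measurable_hull|exact: measurable_cut].
- by rewrite -E; exact: tame_integrable_hull.
- by apply/disj_setPS => t [? []].
Qed.

(** For a different from b, lambda_a vanishes at the centre b of the homothety and
    is multiplied by u; for a = b this fails, whence the condition i = 0.  On K
    minus its image the factor (1 - lambda_b)^m lies between u^m and 1. *)
Lemma moment_squeeze (a : V) (i m : nat) (u N N0 : R) :
  a \in K -> (i == 0%N) || (a != b) -> 0 < u < 1 ->
  N = integral3 (hull K) (fun x => bary K a x ^+ i * (1 - bary K b x) ^+ m) ->
  N0 = integral3 (hull K) (fun x => bary K a x ^+ i) ->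
  u ^+ m * (N0 * (1 - u ^+ (3 + i))) <= N * (1 - u ^+ (3 + i + m)) <= N0 * (1 - u ^+ (3 + i)).
Proof.
move=> aK iab /andP[u0 u1] NE N0E.
have u01 : 0 < u <= 1 by rewrite u0 ltW.
pose h x := bary K a x ^+ i.
pose g x := (1 - bary K b x) ^+ m.
have th : tame h by apply: tameX; exact: tame_bary.
have tg : tame g by apply: tameX; exact: tame_onem_bary.
have b01 x : hull K x -> 0 <= bary K b x <= 1.
  by move=> hx; rewrite bary_le1// andbT; move/(hull_bary _ sK): hx; apply.
have h0 x : hull K x -> 0 <= h x by move=> /(hull_bary _ sK) hx; rewrite exprn_ge0// hx.
have g0 x : hull K x -> 0 <= g x by move=> /b01/andP[_ ?]; rewrite exprn_ge0// subr_ge0.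
have hh x : h (u *: x + (1 - u) *: b) = u ^+ i * h x.
  rewrite /h bary_homothety//; have [ab|ab] := eqVneq a b.
    by move: iab; rewrite ab eqxx orbF => /eqP ->; rewrite !expr0 mulr1.
  by rewrite mulr0 addr0 exprMn.
have gg x : g (u *: x + (1 - u) *: b) = u ^+ m * g x.
  by rewrite /g bary_homothety// eqxx mulr1 -exprMn; congr (_ ^+ _); ring.
have cutE1 : integral3 (cut u) h = u ^+ (3 + i) * N0.
  rewrite integral3_cut//.
  rewrite (eq_integral3 (g := fun x => u ^+ i * h x)); last by move=> x _; exact: hh.
  by rewrite integral3Zl// N0E exprD mulrA.
have cutE2 : integral3 (cut u) (fun x => h x * g x) = u ^+ (3 + i + m) * N.
  rewrite integral3_cut//; [|exact: tameM|by move=> x hx; rewrite mulr_ge0 ?h0 ?g0].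
  rewrite (eq_integral3 (g := fun x => u ^+ (i + m) * (h x * g x))); last first.
    by move=> x _; rewrite hh gg exprD; ring.
  by rewrite integral3Zl ?NE ?mulrA -?exprD ?addnA//; exact: tameM.
have s1 := integral3_split u th; have s2 := integral3_split u (tameM th tg).
have {}s1 : integral3 (hull K `\` cut u) h = N0 * (1 - u ^+ (3 + i)).
  by move: s1; rewrite cutE1 -N0E => e; rewrite mulrBr mulr1 mulrC {1}e addrC addKr.
have {}s2 : integral3 (hull K `\` cut u) (fun x => h x * g x) = N * (1 - u ^+ (3 + i + m)).
  by move: s2; rewrite cutE2 -NE => e; rewrite mulrBr mulr1 mulrC {1}e addrC addKr.
have mD : measurable (coords_of (hull K `\` cut u)).
  by apply: measurableD; [exact: measurable_hull|exact: measurable_cut].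
have DK : hull K `\` cut u `<=` hull K by move=> x [].
rewrite -s1 -s2; apply/andP; split.
  have -> : u ^+ m * integral3 (hull K `\` cut u) h
      = integral3 (hull K `\` cut u) (fun x => u ^+ m * h x).
    by rewrite /integral3 RintegralZl//; exact: tame_integrable.
  apply: le_integral3 => //; [by apply: tameM => //; exact: tame_cst|exact: tameM|].
  move=> x [hx ncut]; rewrite mulrC ler_wpM2l ?h0//.
  rewrite lerXn2r ?nnegrE ?(ltW u0)//; first by have /andP[_] := b01 _ hx; rewrite subr_ge0.
  by rewrite leNgt; apply/negP => bu; apply: ncut; split => //; lra.
apply: le_integral3 => //; first exact: tameM.
move=> x [hx _]; rewrite ler_piMr ?h0//.
have /andP[b0 b1] := b01 _ hx.
by rewrite exprn_ile1//; lra.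
Qed.

End Cut.
End Integral3.

Section Moments.
Variable R : realType.
Local Notation V := 'rV[R]_3.
Local Notation X := (measurableTypeR R * measurableTypeR R * measurableTypeR R)%type.

Lemma poly_ge0_at1 (p : {poly R}) :
  (forall u : R, 0 < u < 1 -> 0 <= p.[u]) -> 0 <= p.[1].
Proof.
move=> p0.
have cp : p.[u] @[u --> 1^'-] --> p.[1].
  by apply: cvg_at_left_filter; exact: continuous_horner.
rewrite -(cvg_lim _ cp)//; apply: limr_ge; first by apply/cvg_ex; exists p.[1].
near=> u; apply: p0; apply/andP; split; near: u.
- exact: nbhs_left_gt.
- exact: nbhs_left_lt.
Unshelve. all: by end_near. Qed.

(** Division of the inequalities by 1 - u leaves polynomials in u, which are
    compared at u = 1. *)
Lemma geometric_squeeze (n m : nat) (N N0 : R) :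
  (forall u : R, 0 < u < 1 ->
    u ^+ m * (N0 * (1 - u ^+ n)) <= N * (1 - u ^+ (n + m)) <= N0 * (1 - u ^+ n)) ->
  (n + m)%:R * N = n%:R * N0.
Proof.
move=> H.
pose G l : {poly R} := \sum_(j < l) 'X^j.
have GE l (u : R) : (1 - u) * (G l).[u] = 1 - u ^+ l.
  rewrite /G horner_sum; under eq_bigr do rewrite hornerXn.
  by rewrite -opprB mulNr -subrX1 opprB.
have G1 l : (G l).[1] = l%:R.
  rewrite /G horner_sum; under eq_bigr do rewrite hornerXn expr1n.
  by rewrite sumr_const card_ord.
have h1 : 0 <= (N *: G (n + m)%N - N0 *: ('X^m * G n)).[1].
  apply: poly_ge0_at1 => u u01; have /andP[u0 u1] := u01; have /andP[H1 _] := H u u01.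
  have u1' : 0 < 1 - u by lra.
  rewrite -(pmulr_rge0 _ u1') !hornerE /=.
  by move: H1; rewrite -(GE n) -(GE (n + m)%N); lra.
have h2 : 0 <= (N0 *: G n - N *: G (n + m)%N).[1].
  apply: poly_ge0_at1 => u u01; have /andP[u0 u1] := u01; have /andP[_ H1] := H u u01.
  have u1' : 0 < 1 - u by lra.
  rewrite -(pmulr_rge0 _ u1') !hornerE /=.
  by move: H1; rewrite -(GE n) -(GE (n + m)%N); lra.
by move: h1 h2; rewrite !hornerE /= !G1 expr1n; lra.
Qed.

Variable K : {fset V}.
Hypothesis sK : simplex 4 K.

Lemma moment a b i m : a \in K -> b \in K -> (i == 0%N) || (a != b) ->
  (3 + i + m)%:R * integral3 (hull K) (fun x => bary K a x ^+ i * (1 - bary K b x) ^+ m)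
  = (3 + i)%:R * integral3 (hull K) (fun x => bary K a x ^+ i).
Proof.
move=> aK bK iab; apply: geometric_squeeze => u u01.
exact: (moment_squeeze sK bK aK iab u01).
Qed.

(** The image of the unit cube under a homothety with small ratio, centred at the
    centroid c of K, lies in K. *)
Lemma volume_gt0 : 0 < volume (hull K).
Proof.
have [cK _] := sK.
have L (z : V) : exists M : R, z \in K -> forall x : V, (forall i, 0 <= x 0 i <= 1) -> - M <= bary K z x.
  have [zK|] := boolP (z \in K); last by exists 0.
  have [a [b E]] := affine_bary sK zK.
  exists (`|b| + \sum_i `|a 0 i|) => _ x x01; rewrite E opprD lerD//.
    by rewrite lerNl -normrN ler_norm.
  rewrite -sumrN; apply: ler_sum => i _; have /andP[x0 x1] := x01 i.
  rewrite lerNl (le_trans (ler_norm _))// normrN normrM ler_piMr//.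
  by rewrite ger0_norm.
have [M0 hM0] := choice L.
pose M := \sum_(z <- K) `|M0 z|.
have M_ge0 : 0 <= M by exact: sumr_ge0.
have hM z (x : V) : z \in K -> (forall i, 0 <= x 0 i <= 1) -> - M <= bary K z x.
  move=> zK x01; rewrite (le_trans _ (hM0 z zK x x01))// lerN2.
  by rewrite (le_trans (ler_norm _))// /M (big_fsetD1 z)//= lerDl sumr_ge0.
(* At the centroid all coordinates are 1/4, and on the cube they are at least
   -M; the ratio e solves (1 - e) / 4 = e * M. *)
pose e := (1 + 4 * M)^-1.
have e0 : 0 < e by rewrite invr_gt0; lra.
have eM : e * (1 + 4 * M) = 1 by rewrite mulVf//; apply: lt0r_neq0; lra.
pose c : V := \sum_(z <- K) 4^-1 *: z.
have c1 : \sum_(z <- K) 4^-1 = 1 :> R.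
  by rewrite big_const_seq count_predT -[size _]/#|`K| cK iter_addr_0 -[LHS]mulr_natr mulVf//.
have bc z : z \in K -> bary K z c = 4^-1.
  by move=> zK; rewrite (@bary_sub_combination R K K (fun=> 4^-1))// zK.
pose phi := homothety3 e (to_coords ((1 - e) *: c)).
pose I : set R := `[0, 1]%classic.
have sub : ((I `*` I) `*` I : set X) `<=` phi @^-1` coords_of (hull K).
  move=> t [[t1 t2] t3]; apply/(hull_bary _ sK) => z zK.
  rewrite of_coords_homothety affine_convex ?(bc z zK)//; last exact: affine_bary.
  have : - M <= bary K z (of_coords t).
    apply: hM => // i; rewrite mxE.
    by move: t1 t2 t3; rewrite /I /= !in_itv/=; case: i => -[|[|[|//]]].
  move=> h; have : e * - M <= e * bary K z (of_coords t) by rewrite ler_pM2l.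
  by lra.
have mI : measurable (I : set (measurableTypeR R)) by exact: measurable_itv.
have mB : measurable ((I `*` I) `*` I : set X) by exact: measurableX (measurableX mI mI) mI.
have mK := measurable_hull sK.
have := leb3_homothety (to_coords ((1 - e) *: c)) e0 mK.
have mphi : measurable_fun setT (phi : X -> X) by exact: measurable_homothety3.
have mpre : measurable (phi @^-1` coords_of (hull K)).
  by rewrite -[X in measurable X]setTI; exact: mphi.
have : (leb3 ((I `*` I) `*` I) <= leb3 (phi @^-1` coords_of (hull K)))%E.
  by apply: le_measure; rewrite ?inE.
rewrite leb3_box ?ler01// subr0 expr1n => h1 h2.
rewrite h2 in h1.
have fK : leb3 (coords_of (hull K)) \is a fin_num.
  by rewrite ge0_fin_numE ?leb3_hull_fin// measure_ge0.
rewrite /volume -[_ @^-1` _]/(coords_of (hull K)).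
move: h1; rewrite -{1}(fineK fK) -EFinM lee_fin => h1.
rewrite ltNge; apply/negP => v0.
have : e^-1 ^+ 3 * fine (leb3 (coords_of (hull K))) <= 0.
  by rewrite pmulr_rle0// exprn_gt0// invr_gt0.
by move/(le_trans h1); rewrite ler10.
Qed.

(** The facet opposite to z avoids the image of K under each homothety centred at
    z with ratio u < 1, so that its measure is at most (1 - u^3) |K|. *)
Lemma facet_plane_null z : z \in K ->
  leb3 (coords_of [set x | hull K x /\ bary K z x = 0]) = 0%E.
Proof.
move=> zK; set N := [set x | _].
have mK := measurable_hull sK.
have fK := leb3_hull_fin sK.
have mN : measurable (coords_of N).
  have -> : coords_of N = coords_of (hull K) `\` ~` [set t : X | 0 <= - bary K z (of_coords t)].
    apply/seteqP; split=> t; rewrite /N /coords_of/=.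
      by move=> [? ->]; split=> //; rewrite oppr0; apply.
    move=> [h] /contrapT; rewrite oppr_ge0 => h0; split=> //; apply/eqP.
    by rewrite eq_le h0/=; move/(hull_bary _ sK): h; apply.
  apply: measurableD => //; apply: measurableC.
  have [a [b E]] := affine_bary sK zK.
  apply: (measurable_halfspace 0 (f := fun x => - bary K z x)).
  exists (- a), (- b) => x; rewrite E opprD -sumrN; congr (_ + _).
  by apply: eq_bigr => i _; rewrite mxE mulNr.
have NK : coords_of N `<=` coords_of (hull K) by move=> t [].
have fN : (leb3 (coords_of N) < +oo)%E.
  by apply: (le_lt_trans _ fK); apply: le_measure; rewrite ?inE.
have N0 : (0 <= leb3 (coords_of N))%E by exact: measure_ge0.
suff v0 : fine (leb3 (coords_of N)) <= 0.
  apply/eqP; rewrite eq_le N0 andbT -[X in (X <= _)%E]fineK ?lee_fin//.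
  by rewrite ge0_fin_numE.
set v := fine _.
have : 0 <= (volume (hull K) *: (1 - 'X^3) - v%:P).[1].
  apply: poly_ge0_at1 => u /andP[u0 u1].
  rewrite !hornerE /= subr_ge0.
  have u01 : 0 < u <= 1 by rewrite u0 ltW.
  have t1 := tame_cst K (1 : R).
  have := integral3_split sK zK u t1.
  rewrite (integral3_cut sK zK u01 t1)// -!volumeE//.
  move=> e; have -> : volume (hull K) * (1 - u ^+ 3) = integral3 (hull K `\` cut K z u) (fun=> 1).
    by rewrite mulrBr mulr1 mulrC {1}e addrC addKr.
  have mD : measurable (coords_of (hull K `\` cut K z u)).
    by apply: measurableD => //; exact: measurable_cut.
  rewrite /integral3 -[_ @^-1` _]/(coords_of (hull K `\` cut K z u)) Rintegral_cst// mul1r.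
  have sub : coords_of N `<=` coords_of (hull K `\` cut K z u).
    by move=> t [h e0]; split=> // -[_]; rewrite e0; lra.
  have fD : (leb3 (coords_of (hull K `\` cut K z u)) < +oo)%E.
    apply: (le_lt_trans _ fK); apply: le_measure; rewrite ?inE//.
    by move=> t [].
  apply: fine_le.
  - by rewrite ge0_fin_numE.
  - by rewrite ge0_fin_numE// measure_ge0.
  - by apply: le_measure; rewrite ?inE.
by rewrite !hornerE /= expr1n subrr mulr0 sub0r oppr_ge0.
Qed.

Lemma space_measurable_indic (A : set V) : measurable (coords_of A) ->
  space_measurable (\1_A : V -> R).
Proof. by move=> mA; exact: (@measurable_indic _ X R setT (coords_of A) mA). Qed.

Lemma tame_indic (A : set V) : measurable (coords_of A) -> tame K (\1_A : V -> R).
Proof.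
move=> mA; split; first exact: space_measurable_indic.
by exists 1 => x _; rewrite indicE; case: (x \in A); rewrite ?normr0 ?normr1.
Qed.

Lemma integral3_indic_null (A : set V) z f : z \in K -> measurable (coords_of A) ->
  tame K f -> (forall x, hull K x -> A x -> bary K z x = 0) ->
  integral3 (hull K) (fun x => \1_A x * f x) = 0.
Proof.
move=> zK mA tf A0.
have mK := measurable_hull sK.
have tg := tameM (tame_indic mA) tf.
rewrite /integral3 /Rintegral.
have mN : measurable (coords_of (hull K `&` A)) by exact: measurableI.
have -> : (\int[@leb3 R]_(t in @of_coords R @^-1` hull K)
    ((\1_A (of_coords t) * f (of_coords t))%:E) =
  \int[@leb3 R]_(t in coords_of (hull K) `\` coords_of (hull K `&` A))
    ((\1_A (of_coords t) * f (of_coords t))%:E))%E.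
  apply: negligible_integral => //; first exact: (tame_integrable_hull sK tg).
  apply: (subset_measure0 mN _ _ (facet_plane_null zK)); last first.
    by move=> t [h1 h2]; split => //; exact: A0.
  have -> : coords_of [set x | hull K x /\ bary K z x = 0] =
     coords_of (hull K) `&` ((fun t : X => bary K z (of_coords t)) @^-1` [set 0]) by [].
  apply: measurableI => //; rewrite -[X in measurable X]setTI.
  apply: (measurable_affine (affine_bary sK zK)) => //; exact: measurable_set1.
rewrite integral0_eq// => t [h1 h2]; rewrite indicE memNset ?mul0r//.
by move=> At; apply: h2.
Qed.

Lemma polyint_power n : polyint ((1 + 'X) ^+ n : {poly R}) = 2 ^+ n.+1 / n.+1%:R.
Proof.
have n0 : n.+1%:R != 0 :> R by rewrite pnatr_eq0.
have -> : (1 + 'X) ^+ n = (n.+1%:R^-1 *: (1 + 'X) ^+ n.+1)^`() :> {poly R}.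
  rewrite derivZ deriv_exp derivD derivX -polyC1 derivC add0r mul1r /=.
  by rewrite -[X in _ *: X]scaler_nat scalerA mulVf// scale1r.
rewrite polyint_deriv !hornerZ !horner_exp !hornerE subrr expr0n/= mulr0 subr0.
by rewrite mulrC.
Qed.

(** By linearity it suffices to take for p a power of 1 + x, which becomes a
    power of 2 (1 - lambda_b); then both sides are given by [moment]. *)
Lemma integral_bary_poly a b i (p : {poly R}) : a \in K -> b \in K ->
  (i == 0%N) || (a != b) ->
  integral3 (hull K) (fun x => bary K a x ^+ i * p.[1 - 2 * bary K b x]) =
  (3 + i)%:R / 2 ^+ (3 + i) * polyint ((1 + 'X) ^+ (2 + i) * p) *
    integral3 (hull K) (fun x => bary K a x ^+ i).
Proof.
move=> aK bK iab.
pose q := p \Po (2%:P * 'X - 1).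
have pq (t : R) : p.[1 - 2 * t] = q.[1 - t].
  by rewrite /q horner_comp !hornerE /=; congr (_.[_]); ring.
have pE : p = \sum_(j < size q) (q`_j / 2 ^+ j) *: (1 + 'X) ^+ j.
  have -> : p = q \Po (2^-1%:P * (1 + 'X)).
    rewrite /q -comp_polyA.
    have -> : (2%:P * 'X - 1) \Po (2^-1%:P * (1 + 'X)) = 'X :> {poly R}.
      rewrite comp_polyB comp_polyM comp_polyX -polyC1 !comp_polyC mulrA -polyCM.
      by rewrite divff ?pnatr_eq0// polyC1 mul1r addrC addKr.
    by rewrite comp_polyXr.
  rewrite comp_polyE; apply: eq_bigr => j _.
  by rewrite exprMn -polyC_exp mul_polyC scalerA exprVn.
have tl := tame_onem_bary sK bK.
have ta : tame K (fun x => bary K a x ^+ i) by apply: tameX; exact: tame_bary.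
set mu := integral3 _ (fun x => bary K a x ^+ i).
transitivity (\sum_(j < size q) q`_j * ((3 + i)%:R / (3 + i + j)%:R * mu)).
  rewrite (eq_integral3 (g := fun x => \sum_(j < size q)
     q`_j * (bary K a x ^+ i * (1 - bary K b x) ^+ j))); last first.
    move=> x _; rewrite pq horner_coef mulr_sumr; apply: eq_bigr => j _; ring.
  rewrite integral3_sum//; last first.
    by move=> j _; apply: tameM; [exact: tame_cst|apply: tameM => //; exact: tameX].
  apply: eq_bigr => j _; rewrite integral3Zl//; last by apply: tameM => //; exact: tameX.
  congr (_ * _); apply: (@mulfI _ (3 + i + j)%:R); first by rewrite pnatr_eq0.
  rewrite moment// mulrA mulrCA mulfV ?mulr1// pnatr_eq0//.
rewrite {1}pE mulr_sumr polyint_sum mulr_sumr mulr_suml; apply: eq_bigr => j _.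
rewrite -[X in polyint X]scalerAr polyintZ -exprD polyint_power.
have -> : (2 + i + j).+1 = (3 + i + j)%N by [].
have : (3 + i + j)%:R != 0 :> R by rewrite pnatr_eq0.
have : 2 ^+ (3 + i) != 0 :> R by rewrite expf_neq0 ?pnatr_eq0.
have : 2 ^+ j != 0 :> R by rewrite expf_neq0 ?pnatr_eq0.
rewrite (exprD _ (3 + i)).
move: (2 ^+ (3 + i)) (2 ^+ j) ((3 + i + j)%:R : R) ((3 + i)%:R : R) => c d e f d0 c0 e0.
by field; rewrite ?c0 ?d0 ?e0.
Qed.

End Moments.

(** * Pairing of the pressure with facet functions *)

Section Pairing.
Variable R : realType.
Local Notation V := 'rV[R]_3.

(** The mean of P(1 - 2 lambda_b) over a tetrahedron. *)
Definition jacobi_mass n : R := 3 / 8 * polyint ((1 + 'X) ^+ 2 * jacobi R 0 3 n).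

Lemma jacobi_mass_neq0 n : jacobi_mass n != 0.
Proof. by rewrite mulf_neq0 ?polyint_jacobi03_neq0// mulf_neq0 ?invr_eq0 ?pnatr_eq0. Qed.

Lemma polyint_jacobi_cube n (r : {poly R}) : (size r <= n)%N ->
  polyint ((1 + 'X) ^+ 3 * (jacobi R 0 3 n * r)) = 0.
Proof.
move=> rn; have := jacobi_orthogonal 0 3 rn.
by rewrite expr0 mul1r mulrA.
Qed.

(** For a = b the polynomial q is split at -1, for distinct a and b it is expanded
    in powers of lambda_a; in both cases [polyint_jacobi_cube] kills all terms
    but the constant one. *)
Lemma integral_jacobi (K : {fset V}) a b n (q : {poly R}) : simplex 4 K ->
  a \in K -> b \in K -> (size q <= n.+1)%N ->
  integral3 (hull K) (fun x => (jacobi R 0 3 n).[1 - 2 * bary K b x] * q.[1 - 2 * bary K a x])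
  = jacobi_mass n * volume (hull K) * q.[if a == b then -1 else 1].
Proof.
move=> sK aK bK qn; set P := jacobi R 0 3 n.
case: eqP => [->|/eqP ab].
  rewrite (eq_integral3 (g := fun x => bary K b x ^+ 0 * (P * q).[1 - 2 * bary K b x])); last first.
    by move=> x _; rewrite expr0 mul1r hornerM.
  rewrite integral_bary_poly//.
  rewrite (eq_integral3 (g := fun=> 1)); last by move=> x _; rewrite expr0.
  rewrite -volumeE// !addn0.
  have [r qE sr] := poly_divXadd1 q.
  have -> : polyint ((1 + 'X) ^+ 2 * (P * q)) = polyint ((1 + 'X) ^+ 2 * P) * q.[-1].
    have -> : (1 + 'X) ^+ 2 * (P * q) =
        q.[-1] *: ((1 + 'X) ^+ 2 * P) + (1 + 'X) ^+ 3 * (P * r).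
      by rewrite {1}qE -mul_polyC; ring.
    have rn : (size r <= n)%N by rewrite (leq_trans sr)// -subn1 leq_subLR add1n.
    by rewrite polyintD polyintZ polyint_jacobi_cube// addr0 mulrC.
  by rewrite /jacobi_mass -/P; field.
pose s := q \Po (1 - 2%:P * 'X).
have ss : (size s <= n.+1)%N.
  rewrite size_comp_poly2//.
  rewrite addrC size_polyDl size_polyN mul_polyC size_scale ?pnatr_eq0// size_polyX//.
  by rewrite size_poly1.
rewrite (eq_integral3 (g := fun x => \sum_(i <- iota 0 n.+1)
   s`_i * (bary K a x ^+ i * P.[1 - 2 * bary K b x]))); last first.
  move=> x _; have -> : q.[1 - 2 * bary K a x] = s.[bary K a x].
    by rewrite /s horner_comp !hornerE.
  rewrite (horner_coef_wide _ ss) -(big_mkord xpredT (fun i => s`_i * bary K a x ^+ i)).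
  by rewrite /index_iota subn0 mulr_sumr; apply: eq_bigr => i _; ring.
have tP : tame K (fun x => P.[1 - 2 * bary K b x]).
  by apply: tame_poly_affine => //; exact: affine_bary.
have tX i : tame K (fun x => bary K a x ^+ i) by apply: tameX; exact: tame_bary.
rewrite integral3_sum//; last by move=> i _; apply: tameM; [exact: tame_cst|exact: tameM].
rewrite [iota _ _]/= big_cons [X in _ + X]big1_seq ?addr0; last first.
  move=> i /=; rewrite mem_iota add1n ltnS => /andP[i1 iin].
  rewrite integral3Zl//; last exact: tameM.
  rewrite integral_bary_poly ?ab ?orbT//.
  case: i i1 iin => // i _ iin.
  have -> : polyint ((1 + 'X) ^+ (2 + i.+1) * P) = 0.
    have -> : (1 + 'X) ^+ (2 + i.+1) * P = (1 + 'X) ^+ 3 * (P * (1 + 'X) ^+ i).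
      by rewrite addnS -addSn exprD; ring.
    apply: polyint_jacobi_cube.
    have -> : 1 + 'X = 'X - (-1)%:P :> {poly R} by rewrite polyCN opprK addrC.
    by rewrite size_exp_XsubC.
  by rewrite mulr0 mul0r mulr0.
rewrite integral3Zl//; last exact: tameM.
rewrite integral_bary_poly//.
rewrite (eq_integral3 (g := fun=> 1)); last by move=> x _; rewrite expr0.
rewrite -volumeE// !addn0.
have -> : s`_0 = q.[1] by rewrite -horner_coef0 /s horner_comp !hornerE ?mulr0 ?subr0.
by rewrite /jacobi_mass -/P; field.
Qed.

(** The gradient of an affine function, read off from its values at the origin
    and at the unit vectors. *)
Definition grad (f : V -> R) : V := \row_i (f (delta_mx 0 i) - f 0).

Lemma affine_gradE f x : affine_fun f -> f x = f 0 + \sum_i grad f 0 i * x 0 i.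
Proof.
move=> [a [b E]].
have f0 : f 0 = b by rewrite E big1 ?addr0// => i _; rewrite mxE mulr0.
have ga i : grad f 0 i = a 0 i.
  rewrite mxE f0 E addrC addKr (bigD1 i)//= big1 ?addr0 ?mxE ?eqxx ?mulr1//.
  by move=> j ji; rewrite mxE eqxx (negPf ji) mulr0.
by rewrite f0 E; congr (_ + _); apply: eq_bigr => i _; rewrite ga.
Qed.

Lemma derive_poly_affine (f : V -> R) (r : {poly R}) (x u : V) : affine_fun f ->
  'D_u (fun y => r.[f y]) x = (r^`()).[f x] * \sum_i grad f 0 i * u 0 i.
Proof.
move=> af; set d := \sum_i _.
pose s := (f x)%:P + d *: 'X : {poly R}.
have E (h : R) : f (h *: u + x) = s.[h].
  rewrite /s hornerD hornerC hornerZ hornerX (affine_gradE (h *: u + x) af) (affine_gradE x af).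
  rewrite /d mulr_suml -addrA -big_split/=; congr (_ + _).
  by apply: eq_bigr => i _; rewrite !mxE; ring.
have -> : 'D_u (fun y => r.[f y]) x = 'D_1 (horner (r \Po s)) (0 : R).
  have s0 : s.[0] = f x by rewrite /s hornerD hornerC hornerZ hornerX mulr0 addr0.
  have H : (fun h : R => h^-1 *: (((fun y : V => r.[f y]) \o shift x) (h *: u) - r.[f x])) =
      (fun h => h^-1 *: ((horner (r \Po s) \o shift 0) h%:A - (r \Po s).[0])).
    by apply/funext => h; rewrite /= /shift E !horner_comp s0 addr0 [h%:A]mulr1.
  by rewrite /derive H.
rewrite derive_val deriv_comp hornerM horner_comp /s derivD derivC derivZ derivX.
by rewrite !hornerE /= !hornerE ?mulr0 ?addr0.
Qed.

Lemma div_poly_affine (f : V -> R) (q : {poly R}) (w x : V) : affine_fun f ->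
  div (fun y => q.[1 - 2 * f y] *: w) x =
  (-2 * \sum_i grad f 0 i * w 0 i) * (q^`()).[1 - 2 * f x].
Proof.
move=> af; rewrite /div mulr_sumr mulr_suml; apply: eq_bigr => i _.
pose r := w 0 i *: (q \Po (1 - 2%:P * 'X)).
have -> : (fun y => (q.[1 - 2 * f y] *: w) 0 i) = (fun y => r.[f y]).
  by apply/funext => y; rewrite mxE /r hornerZ horner_comp !hornerE mulrC.
rewrite derive_poly_affine// (bigD1 i)//= big1 ?addr0; last first.
  by move=> j ji; rewrite [delta_mx _ _ _ _]mxE eqxx (negPf ji) mulr0.
rewrite [delta_mx _ _ _ _]mxE !eqxx mulr1 /r derivZ deriv_comp hornerZ hornerM horner_comp.
by rewrite derivB derivM !derivC derivX !hornerE /=; ring.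
Qed.

Lemma orthogonal_basis_eq0 (b : 3.-tuple V) (u : V) : basis_of fullv b ->
  (forall l, \sum_i u 0 i * tnth b l 0 i = 0) -> u = 0.
Proof.
move=> bb ub.
have uE := coord_basis bb (memvf u).
have uu : \sum_i u 0 i * u 0 i = 0.
  rewrite {2}uE; under eq_bigr do rewrite summxE mulr_sumr.
  rewrite exchange_big big1//= => l _.
  under eq_bigr do rewrite mxE mulrCA.
  by rewrite -mulr_sumr -tnth_nth ub mulr0.
apply/rowP => i; rewrite mxE; apply/eqP; rewrite -sqrf_eq0 expr2.
apply/eqP; move: i (erefl true) => i _.
by apply: (psumr_eq0P (P := xpredT) (F := fun i => u 0 i * u 0 i)) => // j _; rewrite -expr2 sqr_ge0.
Qed.

End Pairing.

Section Pressure.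
Variable R : realType.
Local Notation V := 'rV[R]_3.

Lemma lspan_id (M : lmodType R) (A : set M) u : A u -> lspan A u.
Proof.
by move=> Au; exists 1%N, (fun=> 1), (fun=> u); split=> //; rewrite big_ord1 scale1r.
Qed.

Lemma critical_pressure_spanP (Ks : seq {fset V}) k E p :
  critical_pressure_span Ks k E p ->
  exists c : V -> R, forall x, p x = \sum_(z <- E) c z * critical_pressure Ks k z x.
Proof.
move=> [n [a [e [eP ->]]]].
have zex i : exists z, z \in E /\ e i = critical_pressure Ks k z.
  by have [z zE ez] := eP i; exists z.
have [zf zfP] := choice zex.
exists (fun z => \sum_(i < n | zf i == z) a i) => x.
rewrite fct_sumE.
under [RHS]eq_bigr do rewrite mulr_suml big_mkcond.
rewrite exchange_big/=; apply: eq_bigr => i _.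
have [zE ez] := zfP i; rewrite (big_fsetD1 (zf i))//= eqxx big1_seq ?addr0.
  by rewrite -ez.
by move=> z; rewrite /= !inE eq_sym => /andP[/negPf ->].
Qed.

Variables (Omega : set V) (T : {fset {fset V}}) (E : {fset V}) (Ks : seq {fset V}).
Hypotheses (HT : conforming_mesh Omega T) (HE : critical T E)
  (HKs : star_numbering Omega T E Ks).
Variables (k : nat) (c : V -> R).

Local Notation Kn := (nth fset0 Ks).

Definition pressure (x : V) : R := \sum_(z <- E) c z * critical_pressure Ks k z x.

Lemma star_nth i : (i < size Ks)%N -> Kn i \in T /\ (E `<=` Kn i)%fset.
Proof. by move=> iK; apply/(star_mem HT HE HKs); exact: mem_nth. Qed.

Definition pressure_term z i x : R :=
  (c z * ((-1) ^+ i.+1 / volume (hull (Kn i)))) *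
  (\1_(hull (Kn i)) x * (jacobi R 0 3 k.-1).[1 - 2 * bary (Kn i) z x]).

Lemma pressureE x : pressure x =
  \sum_(z <- E) \sum_(i <- index_enum 'I_(size Ks)) pressure_term z i x.
Proof.
apply: eq_bigr => z _; rewrite /critical_pressure mulr_sumr.
by apply: eq_bigr => i _; rewrite /pressure_term /= !mulrA.
Qed.

Lemma tame_pressure_factor K z i : simplex 4 K -> z \in E -> (i < size Ks)%N ->
  tame K (fun x => (jacobi R 0 3 k.-1).[1 - 2 * bary (Kn i) z x]).
Proof.
move=> sK zE iK; have [KnT EKn] := star_nth iK.
apply: tame_poly_affine => //; apply: affine_bary; first exact: (mesh_simplex HT KnT).
exact: (fsubsetP EKn).
Qed.

Lemma measurable_star i : (i < size Ks)%N -> measurable (coords_of (hull (Kn i))).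
Proof. by move=> /star_nth[iT _]; apply: measurable_hull; exact: (mesh_simplex HT iT). Qed.

Lemma tame_pressure_term K z i : simplex 4 K -> z \in E -> (i < size Ks)%N ->
  tame K (pressure_term z i).
Proof.
move=> sK zE iK; apply: tameM; first exact: tame_cst.
apply: tameM; first by apply: tame_indic => //; exact: measurable_star.
exact: tame_pressure_factor.
Qed.

Lemma tame_pressure K : simplex 4 K -> tame K pressure.
Proof.
move=> sK; have -> : pressure = fun x =>
    \sum_(z <- E) \sum_(i <- index_enum 'I_(size Ks)) pressure_term z i x.
  by apply/funext => x; exact: pressureE.
by apply: tame_sum => // z zE; apply: tame_sum => // i _; exact: tame_pressure_term.
Qed.

(** The intersection is the hull of a set of common vertices, which lies in a
    facet of K. *)
Lemma overlap_null K K' : K \in T -> K' \in T -> K != K' -> forall f, tame K f ->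
  integral3 (hull K) (fun x => \1_(hull K') x * f x) = 0.
Proof.
move=> KT K'T KK' f tf; have sK := mesh_simplex HT KT; have sK' := mesh_simplex HT K'T.
have [_ /(_ _ _ KT K'T)[S [SK SK' KKS]] _] := HT.
have /fset0Pn[z] : (K `\` S != fset0)%fset.
  rewrite fsetD_eq0; apply: contra KK' => KS.
  by rewrite eqEfcard (fsubset_trans KS SK') (sK.1) (sK'.1).
rewrite inE => /andP[zS zK].
apply: (integral3_indic_null sK zK) => //; first exact: measurable_hull.
move=> x hx hx'; apply: (hull_sub_bary0 sK SK zK zS).
by rewrite -KKS.
Qed.

Definition pressure_pairing (K : {fset V}) (g : V -> R) : R :=
  integral3 (hull K) (fun x => pressure x * g x).

Lemma pressure_pairingE K g : K \in T -> tame K g -> pressure_pairing K g =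
  \sum_(z <- E) \sum_(i <- index_enum 'I_(size Ks) | Kn i == K)
    c z * ((-1) ^+ i.+1 / volume (hull K)) *
    integral3 (hull K) (fun x => (jacobi R 0 3 k.-1).[1 - 2 * bary K z x] * g x).
Proof.
move=> KT tg; have sK := mesh_simplex HT KT.
have tJ z i : z \in E -> (i < size Ks)%N -> tame K (fun x =>
    (\1_(hull (Kn i)) x * ((jacobi R 0 3 k.-1).[1 - 2 * bary (Kn i) z x] * g x))).
  move=> zE iK; apply: tameM; first by apply: tame_indic => //; exact: measurable_star.
  by apply: tameM => //; exact: tame_pressure_factor.
rewrite /pressure_pairing (eq_integral3 (g := fun x =>
   \sum_(z <- E) \sum_(i <- index_enum 'I_(size Ks))
     (c z * ((-1) ^+ i.+1 / volume (hull (Kn i)))) *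
  (\1_(hull (Kn i)) x * ((jacobi R 0 3 k.-1).[1 - 2 * bary (Kn i) z x] * g x)))); last first.
  move=> x _; rewrite pressureE mulr_suml; apply: eq_bigr => z _.
  by rewrite mulr_suml; apply: eq_bigr => i _; rewrite /pressure_term -!mulrA.
rewrite integral3_sum//; last first.
  by move=> z zE; apply: tame_sum => // i _; apply: tameM; [exact: tame_cst|exact: tJ].
apply: eq_big_seq => z zE.
rewrite integral3_sum//; last by move=> i _; apply: tameM; [exact: tame_cst|exact: tJ].
rewrite [RHS]big_mkcond; apply: eq_bigr => i _.
rewrite integral3Zl//; last exact: tJ.
case: eqP => [->|/eqP nK]; last first.
  rewrite overlap_null ?mulr0// 1?eq_sym//; first by have [] := star_nth (ltn_ord i).
  by apply: tameM => //; exact: tame_pressure_factor.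
congr (_ * _); apply: eq_integral3 => x hx.
by rewrite indicE mem_set// mul1r.
Qed.

Lemma pressure_pairing_outside K g : K \in T -> K \notin Ks -> tame K g ->
  pressure_pairing K g = 0.
Proof.
move=> KT nK tg; rewrite pressure_pairingE// big1// => z _; rewrite big1// => i /eqP iK.
by rewrite -iK mem_nth in nK.
Qed.

Lemma pressure_pairing_star j a (q : {poly R}) : (0 < k)%N -> (j < size Ks)%N ->
  a \in Kn j -> (size q <= k)%N ->
  pressure_pairing (Kn j) (fun x => q.[1 - 2 * bary (Kn j) a x]) =
  (-1) ^+ j.+1 * jacobi_mass R k.-1 * \sum_(z <- E) c z * q.[if a == z then -1 else 1].
Proof.
move=> k0 jK aj qk; have [jT Ej] := star_nth jK; have sj := mesh_simplex HT jT.
have [uKs _ _ _] := HKs.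
rewrite pressure_pairingE//; last by apply: tame_poly_affine => //; exact: affine_bary.
rewrite mulr_sumr; apply: eq_big_seq => z zE.
rewrite (bigD1 (Ordinal jK))/= ?eqxx//.
rewrite big1 ?addr0; last first.
  move=> i /andP[/eqP ij /eqP nij]; exfalso; apply: nij; apply/val_inj => /=.
  by apply/eqP; rewrite -(nth_uniq fset0 _ _ uKs)// ij.
rewrite integral_jacobi ?prednK//; last exact: (fsubsetP Ej).
have := volume_gt0 sj => /lt0r_neq0 v0.
by field.
Qed.

End Pressure.

Lemma signr_odd_distance (R : pzRingType) i j : (i < j)%N -> odd (j - i) ->
  (-1) ^+ i.+1 = - (-1) ^+ j.+1 :> R.
Proof.
move=> ij oij; rewrite -(subnK (ltnW ij)) -addnS exprD.
by rewrite -[in X in _ = - (X * _)]signr_odd oij expr1 mulN1r opprK.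
Qed.

Section Testing.
Variable R : realType.
Local Notation V := 'rV[R]_3.

Lemma grad_bary_neq0 (K : {fset V}) z : simplex 4 K -> z \in K -> grad (bary K z) != 0.
Proof.
move=> sK zK; have [y] : exists y, y \in (K `\ z)%fset.
  apply/fset0Pn; rewrite -cardfs_eq0.
  by have := cardfsD1 z K; rewrite zK sK.1 add1n => -[<-].
rewrite !inE => /andP[yz yK]; apply/eqP => g0.
have := bary_vertex sK yK zK; have := bary_vertex sK zK zK.
have cst x : bary K z x = bary K z 0.
  rewrite {1}(affine_gradE x (affine_bary sK zK)) g0 big1 ?addr0// => i _.
  by rewrite mxE mul0r.
by rewrite !{1}(cst z, cst y) eqxx (negPf yz) => -> /eqP; rewrite oner_eq0.
Qed.

Lemma grad_scale (f g : V -> R) b : (forall x, g x = b * f x) -> grad g = b *: grad f.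
Proof. by move=> gf; apply/rowP => i; rewrite !mxE !gf mulrBr. Qed.

Variables (Omega : set V) (T : {fset {fset V}}) (E : {fset V}) (Ks : seq {fset V}).
Hypotheses (HT : conforming_mesh Omega T) (HE : critical T E)
  (HKs : star_numbering Omega T E Ks).
Variables (k : nat) (c : V -> R).

Local Notation Kn := (nth fset0 Ks).

Definition facet_pairing (F K : {fset V}) : R :=
  pressure_pairing E Ks k c K
    (fun x => ((CR_Q R k)^`()).[1 - 2 * bary K (opposite_vertex K F) x]).

Section Facet.
Variables (F K : {fset V}).
Hypotheses (KT : K \in T) (FK : facet_of K F).

Lemma L2_div_CR (w : V) :
  L2_div T (pressure E Ks k c) (fun K' x => CR_B T k F K' x *: w) =
  -2 * \sum_i (\sum_(K' <- T | (F `<=` K')%fset)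
     facet_pairing F K' *: grad (bary K' (opposite_vertex K' F))) 0 i * w 0 i.
Proof.
transitivity (\sum_(K' <- T | (F `<=` K')%fset)
    (-2 * \sum_i grad (bary K' (opposite_vertex K' F)) 0 i * w 0 i) * facet_pairing F K').
  rewrite [RHS]big_mkcond; apply: eq_big_seq => K' K'T.
  have sK' := mesh_simplex HT K'T.
  case: ifP => FK'.
    have st : star T F K' by split=> //; exact: hull_subset.
    have fK' : facet_of K' F by split=> //; exact: FK.2.
    have [zK' zF] := opposite_vertexP sK' fK'.
    have ab := affine_bary sK' zK'.
    have -> : (fun x => CR_B T k F K' x *: w) =
        (fun x => (CR_Q R k).[1 - 2 * bary K' (opposite_vertex K' F) x] *: w).
      by apply/funext => x; rewrite /CR_B asboolT.
    rewrite /facet_pairing /pressure_pairing -integral3Zl//; last first.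
      by apply: tameM; [exact: (tame_pressure HT HE HKs)|exact: tame_poly_affine].
    by apply: eq_integral3 => x _; rewrite div_poly_affine// mulrCA.
  have nst : ~ star T F K'.
    move=> [_ hF]; move/negP: FK'; apply.
    exact: (mesh_subset HT KT K'T FK.1 hF).
  rewrite (eq_integral3 (g := fun=> 0)) ?integral3_cst0// => x _.
  rewrite /div big1 ?mulr0// => i _.
  have -> : (fun y => (CR_B T k F K' y *: w) 0 i) = cst 0.
    by apply/funext => y; rewrite /CR_B asboolF// scale0r mxE.
  exact: derive_cst.
under [in RHS]eq_bigr do rewrite summxE mulr_suml.
rewrite exchange_big mulr_sumr; apply: eq_bigr => K' _ /=.
rewrite -mulrA mulr_suml; congr (_ * _); apply: eq_bigr => i _.
rewrite [in RHS]mxE; ring.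
Qed.

(** Testing with a basis shows that the sum of all contributions at F is zero as
    a vector.  If every other tetrahedron contributes a nonnegative multiple of
    the contribution of K, nothing can cancel. *)
Lemma facet_pairing_eq0 (b : 3.-tuple V) : basis_of fullv b ->
  (forall l, L2_div T (pressure E Ks k c) (fun K' x => CR_B T k F K' x *: tnth b l) = 0) ->
  (forall K', K' \in T -> facet_of K' F -> K' != K -> exists2 g, 0 <= g &
     facet_pairing F K' *: grad (bary K' (opposite_vertex K' F)) =
     g *: (facet_pairing F K *: grad (bary K (opposite_vertex K F)))) ->
  facet_pairing F K = 0.
Proof.
move=> bb orth neigh.
have sK := mesh_simplex HT KT.
have [zK _] := opposite_vertexP sK FK.
have /(orthogonal_basis_eq0 bb) : forall l, \sum_i (\sum_(K' <- T | (F `<=` K')%fset)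
     facet_pairing F K' *: grad (bary K' (opposite_vertex K' F))) 0 i * tnth b l 0 i = 0.
  move=> l; have /eqP := orth l; rewrite L2_div_CR mulf_eq0 oppr_eq0 pnatr_eq0/=.
  by move/eqP.
pose G K' := facet_pairing F K' *: grad (bary K' (opposite_vertex K' F)).
change (\sum_(K' <- T | (F `<=` K')%fset) G K' = 0 -> facet_pairing F K = 0).
have /choice[g gP] : forall K', exists g, 0 <= g /\ (K' \in T -> (F `<=` K')%fset -> K' != K ->
    G K' = g *: G K).
  move=> K'; have [h|h] := pselect [/\ K' \in T, (F `<=` K')%fset & K' != K].
    have [K'T FK' KK'] := h; have fK' : facet_of K' F by split=> //; exact: FK.2.
    by have [g g0 gE] := neigh _ K'T fK' KK'; exists g.
  by exists 0; split=> // ? ? ?; case: h.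
pose gF K' := if (F `<=` K')%fset then g K' else 0.
rewrite big_mkcond (bigD1_seq K)/= ?FK.1 ?fset_uniq//.
rewrite big_seq_cond (eq_bigr (fun K' => gF K' *: G K)); last first.
  move=> K' /andP[K'T KK']; rewrite /gF; case: ifP => FK'; last by rewrite scale0r.
  by have [_ ->] := gP K'.
rewrite -scaler_suml -{1}[G K]scale1r -scalerDl => /eqP.
rewrite scaler_eq0 => /orP[/eqP s0|].
  have : 0 <= \sum_(i <- T | (i \in T) && (i != K)) gF i.
    by apply: sumr_ge0 => K' _; rewrite /gF; case: ifP => // _; have [] := gP K'.
  lra.
by rewrite scaler_eq0 (negPf (grad_bary_neq0 sK zK)) orbF => /eqP.
Qed.

End Facet.
End Testing.

Theorem theorem6p2 (R : realType) (Omega : set 'rV[R]_3)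
    (T : {fset {fset 'rV[R]_3}}) (k : nat) (E K F G : {fset 'rV[R]_3})
    (Ks : seq {fset 'rV[R]_3}) (w : {fset 'rV[R]_3} -> 3.-tuple 'rV[R]_3)
    (p : 'rV[R]_3 -> R^o)
    (HOmega : polyhedral_domain Omega) (HT : conforming_mesh Omega T)
    (Hk : (3 <= k)%N) (Hodd : odd k)
    (HE : critical T E) (HKs : star_numbering Omega T E Ks)
    (HK : star T E K)
    (HFK : facet_of K F) (HGK : facet_of K G)
    (HF : inner_facet Omega T F) (HG : inner_facet Omega T G)
    (HEF : hull E `<=` hull F) (HEG : ~ (hull E `<=` hull G))
    (Hw : forall F', inner_facet Omega T F' -> basis_of fullv (w F'))
    (Hp : critical_pressure_span Ks k E p)
    (Horth : forall v, CR_span T k w [set F' | F' = F \/ F' = G] v ->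
       L2_div T p v = 0) :
  forall x, p x = 0.
Proof.
have [c pE] := critical_pressure_spanP Hp.
have {}pE : p = pressure E Ks k c by apply/funext => x; exact: pE.
have k0 : (0 < k)%N by exact: leq_trans Hk.
have [_ KsE _ _] := HKs.
have KKs : K \in Ks by have : [set` Ks] K by rewrite KsE.
have [KT EK] := (star_mem HT HE HKs K).1 KKs.
have [j jK KE] : exists2 j, (j < size Ks)%N & nth fset0 Ks j = K.
  by exists (index K Ks); rewrite ?index_mem ?nth_index.
have sK := mesh_simplex HT KT.
have EF : (E `<=` F)%fset.
  apply/fsubsetP => v vE; apply: (vertex_hull_sub sK HFK.1 (fsubsetP EK v vE)).
  by apply: HEF; exact: hull_vertex.
have orth F' : F' = F \/ F' = G -> forall l,
    L2_div T (pressure E Ks k c) (fun K' x => CR_B T k F' K' x *: tnth (w F') l) = 0.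
  move=> F'FG l; rewrite -pE; apply: Horth; apply: lspan_id.
  by exists F', l.
pose Q := (CR_Q R k)^`().
have sQ : (size Q <= k)%N by exact: size_CR_Q_deriv.
have pairE i F' : (i < size Ks)%N -> facet_of (nth fset0 Ks i) F' ->
    facet_pairing E Ks k c F' (nth fset0 Ks i) = (-1) ^+ i.+1 * jacobi_mass R k.-1 *
    \sum_(z <- E) c z * Q.[if opposite_vertex (nth fset0 Ks i) F' == z then -1 else 1].
  move=> iK fF'; rewrite /facet_pairing.
  have sKi := mesh_simplex HT (star_nth HT HE HKs iK).1.
  have [zK _] := opposite_vertexP sKi fF'.
  exact: (pressure_pairing_star HT HE HKs).
have unit_factor i : (-1) ^+ i.+1 * jacobi_mass R k.-1 != 0.
  by rewrite mulf_neq0 ?jacobi_mass_neq0// expf_neq0// oppr_eq0 oner_eq0.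
have Q1 : Q.[1] = k%:R * (k%:R + 2) / 2 := CR_Q_deriv_at1 R k.
have QN1 : Q.[-1] = k%:R * (k%:R + 1) * (k%:R + 2) / 4 := CR_Q_deriv_atN1 R Hodd.
have kr3 : 3 <= k%:R :> R by rewrite (ler_nat _ 3).
(* Testing with F: the signs of p and of the gradients both change from K to its
   neighbour, so the contributions have the same direction. *)
have sum_c : \sum_(z <- E) c z = 0.
  have : facet_pairing E Ks k c F K = 0.
    apply: (facet_pairing_eq0 HT HE HKs KT HFK (Hw F HF)); first by apply: orth; left.
    move=> K' K'T FK' KK'.
    have [zK zF] := opposite_vertexP sK HFK.
    have [zK' zF'] := opposite_vertexP (mesh_simplex HT K'T) FK'.
    have KK'' : K != K' by rewrite eq_sym.
    have [b b0 bE] := opposite_sides HT KT K'T KK'' HFK FK' zK zF zK' zF'.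
    exists (- b); first by rewrite oppr_ge0 ltW.
    rewrite (grad_scale bE) !scalerA; congr (_ *: _).
    have K'Ks : K' \in Ks.
      by apply/(star_mem HT HE HKs); split=> //; exact: fsubset_trans EF FK'.1.
    have [i iK K'E] : exists2 i, (i < size Ks)%N & nth fset0 Ks i = K'.
      by exists (index K' Ks); rewrite ?index_mem ?nth_index.
    have FKj : facet_of (nth fset0 Ks j) F by rewrite KE.
    have FKi : facet_of (nth fset0 Ks i) F by rewrite K'E.
    rewrite -KE -K'E !pairE// KE K'E.
    have sumE z0 : z0 \notin F -> \sum_(z <- E) c z * Q.[if z0 == z then -1 else 1] =
        \sum_(z <- E) c z * Q.[1].
      move=> z0F; apply: eq_big_seq => z zE; case: eqP => // z0z.
      by rewrite z0z (fsubsetP EF) in z0F.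
    rewrite !sumE//.
    suff -> : (-1) ^+ i.+1 = - (-1) ^+ j.+1 :> R by ring.
    have [ij|ji|ij] := ltngtP i j.
    - by apply: signr_odd_distance => //; apply: (neighbours_opposite_parity HT HE HKs (F := F)); rewrite ?ij.
    - rewrite (signr_odd_distance R ji) ?opprK//.
      by apply: (neighbours_opposite_parity HT HE HKs (F := F)); rewrite ?ji.
    - by rewrite -K'E -KE ij eqxx in KK'.
  rewrite -KE pairE ?KE// => /eqP; rewrite mulf_eq0 (negPf (unit_factor j))/=.
  have [zK zF] := opposite_vertexP sK HFK.
  rewrite (eq_big_seq (fun z => c z * Q.[1])); last first.
    move=> z zE; case: eqP => // z0z.
    by rewrite z0z (fsubsetP EF) in zF.
  rewrite -mulr_suml mulf_eq0 => /orP[/eqP//|/eqP]; rewrite Q1; nra.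
(* Testing with G: the neighbour of K at G does not belong to the star of E. *)
have [zK zG] := opposite_vertexP sK HGK.
set z0 := opposite_vertex K G in zK zG.
have z0E : z0 \in E.
  apply/negPn/negP => z0E; apply: HEG; apply: hull_subset.
  rewrite (facet_vertices sK HGK zK zG); apply/fsubsetP => v vE.
  by rewrite !inE (fsubsetP EK)// andbT; apply: contraNneq z0E => <-.
have G0 : facet_pairing E Ks k c G K = 0.
  apply: (facet_pairing_eq0 HT HE HKs KT HGK (Hw G HG)); first by apply: orth; right.
  move=> K' K'T GK' KK'; exists 0 => //; rewrite scale0r.
  suff -> : facet_pairing E Ks k c G K' = 0 by rewrite scale0r.
  have sK' := mesh_simplex HT K'T.
  apply: (pressure_pairing_outside HT HE HKs) => //; last first.
    by apply: tame_poly_affine => //; apply: affine_bary => //; have [] := opposite_vertexP sK' GK'.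
  apply: contra KK' => /(star_mem HT HE HKs K').1[_ EK'].
  apply/eqP/esym/(mesh_facet_subset_eq HT KT K'T HGK GK' zK zG).
  exact: (fsubsetP EK').
move: G0; rewrite -KE pairE ?KE// -/z0 => /eqP; rewrite mulf_eq0 (negPf (unit_factor j))/=.
rewrite (big_fsetD1 z0)//= eqxx.
rewrite (eq_big_seq (fun z => c z * Q.[1])); last first.
  by move=> z; rewrite !inE => /andP[/negPf zz0 _]; rewrite eq_sym zz0.
move: sum_c; rewrite (big_fsetD1 z0)//= -mulr_suml => /eqP; rewrite addr_eq0 => /eqP cz0.
rewrite cz0 mulNr addrC -mulrBr mulf_eq0 => /orP[/eqP s0|/eqP]; last first.
  rewrite Q1 QN1 => e; exfalso.
  have : (k%:R * (k%:R + 2)) * (k%:R - 1) = 0 :> R by lra.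
  by move/eqP; rewrite !mulf_eq0 => /orP[/orP[]|] /eqP; lra.
have [_ _ [_ E2]] := HE.1.
have /eqP/cardfs1P[e Ee] : #|` (E `\ z0)%fset| = 1%N.
  by have := cardfsD1 z0 E; rewrite z0E E2 add1n => -[].
rewrite Ee big_seq_fset1 in s0 cz0.
move=> x; rewrite pE /pressure (big_fsetD1 z0)//= Ee big_seq_fset1.
by rewrite cz0 s0 oppr0 !mul0r addr0.
Qed.
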